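(* Every infinite-dimensional separable Banach space can be equivalently renormed to fail the weak-BPBp-nu (and so, in particular, to fail the BPBp-nu).
   Context: For a real or complex Banach space $X$ with dual $X^*$ and unit sphere $S_X$, $\mathcal{L}(X)$ is the space of bounded linear operators on $X$ with the operator norm, $\Pi(X)=\{(x,x^* )\in S_X\times S_{X^*} : x^*(x)=1\}$, and the numerical radius of $T\in\mathcal{L}(X)$ is $v(T)=\sup\{|x^*(Tx)| : (x,x^* )\in\Pi(X)\}$. BPBp-nu (Bishop-Phelps-Bollobás property for numerical radius): for every $0<\varepsilon<1$ there exists $\eta(\varepsilon)>0$ such that whenever $T\in\mathcal{L}(X)$ and $(x,x^* )\in\Pi(X)$ satisfy $v(T)=1$ and $|x^*(Tx)|>1-\eta(\varepsilon)$, there exist $S\in\mathcal{L}(X)$ and $(y,y^* )\in\Pi(X)$ with $v(S)=|y^*(Sy)|=1$, $\|T-S\|<\varepsilon$, $\|x-y\|<\varepsilon$ and $\|x^*-y^*\|<\varepsilon$. weak-BPBp-nu: given $\varepsilon>0$ there exists $\eta(\varepsilon)>0$ such that whenever $T_0\in\mathcal{L}(X)$ with $v(T_0)=1$ and $(x_0,x_0^* )\in\Pi(X)$ satisfy $|x_0^*(T_0x_0)|>1-\eta(\varepsilon)$, there exist $S\in\mathcal{L}(X)$ and $(y,y^* )\in\Pi(X)$ with $v(S)=|y^*(Sy)|$, $\|x_0-y\|<\varepsilon$, $\|x_0^*-y^*\|<\varepsilon$ and $\|S-T_0\|<\varepsilon$. (The only difference from the BPBp-nu is that $v(S)=1$ is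 not required.) *)

(* Defs.v *)
From HB Require Import structures.
From mathcomp Require Export all_boot all_order all_algebra.
From mathcomp Require Export complex.
From mathcomp Require Export all_classical all_reals topology normedtype.
Set Implicit Arguments.
Unset Strict Implicit.
Unset Printing Implicit Defensive.
Export Order.TTheory GRing.Theory Num.Theory.
Export numFieldNormedType.Exports.
Local Open Scope classical_set_scope.
Local Open Scope ring_scope.

(* The scalar field K is meant to be a realType R or its complexification R[i];
   in both cases norms take their values in K.  The order of R[i] compares only
   numbers with equal imaginary parts, so [0 < e] in R[i] says that e is real
   and positive, and the supremum in R[i] of a nonempty bounded set of
   nonnegative reals is its usual (real) supremum. *)

Definition separable_space (T : topologicalType) : Prop :=
  exists2 D : set T, countable D & dense D.

Definition infinite_dimensional (K : fieldType) (V : lmodType K) : Prop :=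
  ~ exists (n : nat) (e : 'I_n -> V),
      forall x : V, exists c : 'I_n -> K, x = \sum_(i < n) c i *: e i.

Definition bounded_op (K : numFieldType) (X Y : normedModType K)
    (T : X -> Y) : Prop :=
  exists M : K, forall x : X, `|T x| <= M * `|x|.

Definition op_norm (K : numFieldType) (X Y : normedModType K)
    (T : X -> Y) : K :=
  supremum 0 [set `|T x| | x in [set x : X | `|x| <= 1]].

Definition Pi_set (K : numFieldType) (X : normedModType K) :
    set (X * {linear X -> K^o}) :=
  [set z : X * {linear X -> K^o} |
    [/\ `|z.1| = 1, bounded_op z.2, op_norm z.2 = 1 & z.2 z.1 = 1]].

Definition num_radius (K : numFieldType) (X : normedModType K)
    (T : X -> X) : K :=
  supremum 0 [set `|z.2 (T z.1)| | z in @Pi_set K X].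

Definition BPBp_nu (K : numFieldType) (X : normedModType K) : Prop :=
  forall e : K, 0 < e -> e < 1 -> exists eta : K, 0 < eta /\
  forall (T : {linear X -> X}) (x : X) (f : {linear X -> K^o}),
    bounded_op T -> Pi_set (x, f) ->
    num_radius T = 1 -> 1 - eta < `|f (T x)| ->
    exists (S : {linear X -> X}) (y : X) (g : {linear X -> K^o}),
      [/\ bounded_op S, Pi_set (y, g),
          num_radius S = `|g (S y)| /\ `|g (S y)| = 1,
          op_norm (T \- S) < e
        & `|x - y| < e /\ op_norm (f \- g) < e].

Definition weak_BPBp_nu (K : numFieldType) (X : normedModType K) : Prop :=
  forall e : K, 0 < e -> exists eta : K, 0 < eta /\
  forall (T : {linear X -> X}) (x : X) (f : {linear X -> K^o}),
    bounded_op T -> Pi_set (x, f) ->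
    num_radius T = 1 -> 1 - eta < `|f (T x)| ->
    exists (S : {linear X -> X}) (y : X) (g : {linear X -> K^o}),
      [/\ bounded_op S, Pi_set (y, g),
          num_radius S = `|g (S y)|,
          op_norm (S \- T) < e
        & `|x - y| < e /\ op_norm (f \- g) < e].

Record norm_on (K : numFieldType) (V : lmodType K) := NormOn {
  norm_fun :> V -> K;
  norm_onD : forall x y, norm_fun (x + y) <= norm_fun x + norm_fun y;
  norm_onZ : forall (a : K) x, norm_fun (a *: x) = `|a| * norm_fun x;
  norm_on0_eq0 : forall x, norm_fun x = 0 -> x = 0
}.

(* Equivalent to the norm that X carries. *)
Definition equivalent_norm (K : numFieldType) (X : normedModType K)
    (p : norm_on X) : Prop :=
  exists c C : K, [/\ 0 < c, 0 < C &
    forall x : X, c * `|x| <= p x /\ p x <= C * `|x|].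

(* The vector space V, with p as its norm and the topology that p induces. *)
Definition renormed (K : numFieldType) (V : lmodType K) (p : norm_on V) : Type
  := V.

Section Renormed.
Variables (K : numFieldType) (V : lmodType K) (p : norm_on V).

HB.instance Definition _ := GRing.Lmodule.on (renormed p).
HB.instance Definition _ := Lmodule_isNormed.Build K (renormed p)
  (@norm_onD K V p) (@norm_onZ K V p) (@norm_on0_eq0 K V p).

End Renormed.

(* Main.v *)
From HB Require Import structures.
Require Import Defs.
From mathcomp Require Import ring lra sequences.
Set Implicit Arguments.
Unset Strict Implicit.
Unset Printing Implicit Defensive.
Local Open Scope classical_set_scope.
Local Open Scope ring_scope.

(** Write X = K e1 + K e2 + Y and give X the norm |a1| + |a2| + q, where a1, a2
are the coordinates along e1, e2 and q is a norm on Y; so X becomes the l1-sum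
of an l1-plane and (Y, q).  An operator which is 0 on Y and maps the plane into
Y has numerical radius max (q (T e1), q (T e2)), because functionals on an
l1-sum can be chosen independently on the summands.

Why such a space fails the property: let T e1 and T e2 be two vectors of Y that
are far apart, of norm almost 1, whose midpoint also has norm almost 1.  At
(e1 + e2) / 2, together with a functional that norms the midpoint, T almost
attains its numerical radius.  Suppose that U is close to T and attains its
numerical radius v at a state (y, g), that is |y| = |g| = g y = 1, with y close
to (e1 + e2) / 2.  Then y is a convex combination, with nonzero weights at e1 and e2 up to unimodular factors,
of vectors at which g is also a state, so |g (U e1)| = |g (U e2)| = v
([attaining_vertices]).  Changing g on Y alone gives other states at e1 and e2,
and as none of them can do better than v, the functional g norms the
Y-components of U e1 and of U e2 ([off_plane_normed]).  If q is strictly convex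
at these two components, they are therefore proportional
([normed_pair_aligned]), whereas they are close to T e1 and T e2, which point in
different directions ([far_from_attaining]).

What remains is a norm q with enough strict convexity, but none that is uniform.
Split once more Y = K e3 + Z and take
   q x = max (|a3 x|, |Q x|) + sum_n 2^-(n+1) sqrt (|a3 x|^2 + |f_n (Q x)|^2),
where Q is the projection onto Z and the f_n are functionals of norm at most 1
that separate points; they exist as X is separable.  Equality in the triangle
inequality for q forces it in every term of the sum, hence proportionality of
all the pairs (a3, f_n Q) ([rotund_strict]), and of the vectors themselves when
a3 is not zero at them.  But if z in Z is a unit vector killed by f_n for all
n < m, which exists in infinite dimension, then e3 + z and e3 - z have norm at
most 2 + 2^-m, and their midpoint e3 has norm 2 ([rotund_flat]).

Real and complex scalars are treated together: [scalars] collects the few facts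
about K that the argument uses, among them the Hahn-Banach theorem, which is
proved here by showing that a minimal sublinear functional is linear. *)

(** * Dyadic weighted sums *)

Section DyadicSum.
Variable R : realType.
Implicit Types b c : nat -> R.

Definition dyadic_term b n : R := 2^-1 ^+ n.+1 * b n.
Definition dyadic_sum b : R := limn (series (dyadic_term b)).
Definition bounded_by (M : R) b := forall n, 0 <= b n <= M.

Lemma dyadic_weight_gt0 n : 0 < 2^-1 ^+ n :> R.
Proof. by rewrite exprn_gt0 ?invr_gt0. Qed.

Lemma dyadic_term_ge0 b n : 0 <= b n -> 0 <= dyadic_term b n.
Proof. by move=> b0; rewrite mulr_ge0 // ltW // dyadic_weight_gt0. Qed.

(** The first m terms vanish, and the remaining weights add up to 2^-m at most.
The bound for m = 0 also gives convergence. *)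
Lemma dyadic_series_le M b m n : bounded_by M b ->
  (forall k, (k < m)%N -> b k = 0) ->
  series (dyadic_term b) n <= M * 2^-1 ^+ m.
Proof.
move=> bM b0.
have M0 : 0 <= M by have /andP[/le_trans] := bM 0%N; apply.
have S0 k : (k <= m)%N -> series (dyadic_term b) k = 0.
  move=> km; rewrite /series /= big_nat big1 // => i /andP[_ ik].
  by rewrite /dyadic_term b0 ?mulr0 // (leq_trans ik).
have [/S0 ->|/ltnW/subnKC <-] := leqP n m.
  by rewrite mulr_ge0 // ltW // dyadic_weight_gt0.
elim: (n - m)%N => [|j].
  by rewrite addn0 S0 // mulr_ge0 // ltW // dyadic_weight_gt0.
suff H i : series (dyadic_term b) (m + i)%N + M * 2^-1 ^+ (m + i) <= M * 2^-1 ^+ m.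
  by move=> _; have := H j.+1; have := dyadic_weight_gt0 (m + j.+1); nra.
elim: i => [|i IH]; first by rewrite addn0 (S0 m (leqnn m)) add0r lexx.
rewrite addnS seriesSr /dyadic_term; have /andP[_] := bM (m + i)%N.
rewrite exprS; have := dyadic_weight_gt0 (m + i); nra.
Qed.

Lemma dyadic_cvg M b : bounded_by M b -> cvgn (series (dyadic_term b)).
Proof.
move=> bM; apply: nondecreasing_is_cvgn.
  by apply: nondecreasing_series => n _ _; apply: dyadic_term_ge0; case/andP: (bM n).
by exists (M * 2^-1 ^+ 0) => _ [n _ <-]; exact: dyadic_series_le.
Qed.

Lemma dyadic_sum_tail M b m : bounded_by M b ->
  (forall k, (k < m)%N -> b k = 0) -> dyadic_sum b <= M * 2^-1 ^+ m.
Proof.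
move=> bM b0; apply: limr_le; first exact: dyadic_cvg bM.
by apply: nearW => n; exact: dyadic_series_le.
Qed.

Lemma dyadic_sum_le M b : bounded_by M b -> dyadic_sum b <= M.
Proof. by move=> bM; rewrite -[M]mulr1; exact: (@dyadic_sum_tail M b 0). Qed.

Lemma dyadic_sumD M N b c : bounded_by M b -> bounded_by N c ->
  dyadic_sum (fun n => b n + c n) = dyadic_sum b + dyadic_sum c.
Proof.
move=> /dyadic_cvg bM /dyadic_cvg cN; rewrite -lim_seriesD //.
by congr (limn (series _)); apply/funext => n; rewrite /dyadic_term mulrDr.
Qed.

Lemma dyadic_sumZ M b a : bounded_by M b ->
  dyadic_sum (fun n => a * b n) = a * dyadic_sum b.
Proof.
move=> /dyadic_cvg bM; rewrite -[RHS]/(a *: (_ : R^o)) -lim_seriesZ //.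
by congr (limn (series _)); apply/funext => n; rewrite /dyadic_term mulrCA.
Qed.

Lemma ler_dyadic_sum M N b c : bounded_by M b -> bounded_by N c ->
  (forall n, b n <= c n) -> dyadic_sum b <= dyadic_sum c.
Proof.
move=> /dyadic_cvg bM /dyadic_cvg cN bc; apply: lim_series_le => // n.
by rewrite ler_wpM2l // ltW // dyadic_weight_gt0.
Qed.

Lemma dyadic_sum_cst a : dyadic_sum (fun=> a) = a.
Proof.
apply/cvg_lim => //; have := @cvg_geometric_series_half R a 0.
rewrite expr0 divr1 [X in series X](_ : _ = dyadic_term (fun=> a)) //.
by apply/funext => n; rewrite /dyadic_term natrX -exprVn addn1 mulrC.
Qed.

(** This is what transfers an equality between sums to each of their terms:
no weight is zero. *)
Lemma dyadic_sum_eq0 M b : bounded_by M b -> dyadic_sum b <= 0 ->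
  forall n, b n = 0.
Proof.
move=> bM s0 n; have b0 k : 0 <= dyadic_term b k.
  by apply: dyadic_term_ge0; case/andP: (bM k).
have le_s : series (dyadic_term b) n.+1 <= dyadic_sum b.
  apply: nondecreasing_cvgn_le; last exact: dyadic_cvg bM.
  by apply: nondecreasing_series => k _ _.
have : dyadic_term b n <= 0.
  apply: le_trans (le_trans le_s s0).
  by rewrite seriesSr lerDr; apply: sumr_ge0.
rewrite /dyadic_term pmulr_rle0 ?dyadic_weight_gt0 // => bn.
by apply/eqP; rewrite eq_le bn; case/andP: (bM n) => ->.
Qed.

End DyadicSum.

(** * Equality in the triangle inequality of the plane *)

Section EuclideanPlane.
Variable R : rcfType.
Implicit Types r s : R.

Definition hypot r s : R := Num.sqrt (r ^+ 2 + s ^+ 2).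

Lemma hypot_ge0 r s : 0 <= hypot r s. Proof. exact: sqrtr_ge0. Qed.

Lemma sqr_hypot r s : hypot r s ^+ 2 = r ^+ 2 + s ^+ 2.
Proof. by rewrite sqr_sqrtr // addr_ge0 // sqr_ge0. Qed.

Lemma hypotZ t r s : 0 <= t -> hypot (t * r) (t * s) = t * hypot r s.
Proof.
move=> t0; apply/eqP; rewrite -(eqrXn2 (n := 2)) ?mulr_ge0 ?hypot_ge0 //.
by rewrite exprMn !sqr_hypot; apply/eqP; ring.
Qed.

Lemma hypot_r0 r : 0 <= r -> hypot r 0 = r.
Proof. by move=> r0; rewrite /hypot expr0n addr0 sqrtr_sqr ger0_norm. Qed.

Lemma hypot_ge_l r s : r <= hypot r s.
Proof.
rewrite (le_trans (ler_norm r)) // -sqrtr_sqr ler_wsqrtr // lerDl.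
exact: sqr_ge0.
Qed.

Lemma hypot_le r s : 0 <= r -> 0 <= s -> hypot r s <= r + s.
Proof.
move=> r0 s0; rewrite -(ler_pXn2r (n := 2)) ?nnegrE ?hypot_ge0 ?addr_ge0 //.
by rewrite sqr_hypot; nra.
Qed.

Lemma le_hypot r s r' s' : 0 <= r -> 0 <= s -> r <= r' -> s <= s' ->
  hypot r s <= hypot r' s'.
Proof. by move=> r0 s0 rr ss; apply: ler_wsqrtr; nra. Qed.

Lemma hypot_dot_le r s r' s' : r * r' + s * s' <= hypot r s * hypot r' s'.
Proof.
apply: le_trans (ler_norm _) _.
rewrite -(ler_pXn2r (n := 2)) ?nnegrE ?mulr_ge0 ?hypot_ge0 //.
rewrite exprMn !sqr_hypot real_normK ?num_real // -subr_ge0.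
by rewrite [leRHS](_ : _ = (r * s' - r' * s) ^+ 2) ?sqr_ge0 //; ring.
Qed.

Lemma hypotD r s r' s' : 
  hypot (r + r') (s + s') <= hypot r s + hypot r' s'.
Proof.
rewrite -(ler_pXn2r (n := 2)) ?nnegrE ?addr_ge0 ?hypot_ge0 //.
rewrite sqr_hypot; have := hypot_dot_le r s r' s'.
have := sqr_hypot r s; have := sqr_hypot r' s'; nra.
Qed.

(** Strict convexity of the Euclidean norm, for use with A and B the moduli of
sums of scalars: equality is possible only if no modulus drops and the two
vectors of moduli are proportional. *)
Lemma hypotD_eq A B r s r' s' : 0 <= A <= r + r' -> 0 <= B <= s + s' ->
  hypot A B = hypot r s + hypot r' s' ->
  [/\ A = r + r', B = s + s' & r * s' = r' * s].
Proof.
move=> /andP[A0 Ar] /andP[B0 Bs] e.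
have : hypot A B ^+ 2 = (hypot r s + hypot r' s') ^+ 2 by rewrite e.
have := hypot_dot_le r s r' s'.
have := sqr_hypot r' s'; have := sqr_hypot r s; rewrite (sqr_hypot A) => h1 h2 h3 h4.
have A2 : A ^+ 2 <= (r + r') ^+ 2 by nra.
have B2 : B ^+ 2 <= (s + s') ^+ 2 by nra.
rewrite !sqrrD in A2 B2 h4.
have eA : A ^+ 2 = (r + r') ^+ 2 by rewrite sqrrD; lra.
have eB : B ^+ 2 = (s + s') ^+ 2 by rewrite sqrrD; lra.
split.
- by apply/eqP; rewrite -(eqrXn2 (n := 2)) ?eA // (le_trans A0).
- by apply/eqP; rewrite -(eqrXn2 (n := 2)) ?eB // (le_trans B0).
have d : hypot r s * hypot r' s' = r * r' + s * s' by lra.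
have : (hypot r s * hypot r' s') ^+ 2 = (r * r' + s * s') ^+ 2 by rewrite d.
rewrite exprMn h1 h2 => h5.
apply/eqP; rewrite -subr_eq0 -sqrf_eq0; apply/eqP; lra.
Qed.

End EuclideanPlane.

(** * Linear functionals below a sublinear one *)

Section Sublinear.
Variables (R : realType) (K : numFieldType) (io : {rmorphism R -> K}).
Variable V : lmodType K.
Implicit Types (s q : V -> R) (x y : V).

(** Real scalars act through the embedding io, so that the same statement
serves real and complex vector spaces. *)
Record sublinear s : Prop := Sublinear {
  sublinearD : forall x y, s (x + y) <= s x + s y;
  sublinearZ : forall t x, 0 <= t -> s (io t *: x) = t * s x }.

Lemma sublinear0 s : sublinear s -> s 0 = 0.
Proof. by move=> ss; rewrite -(scale0r 0) -(rmorph0 io) sublinearZ // mul0r. Qed.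

Lemma sublinearN s x : sublinear s -> - s (- x) <= s x.
Proof.
move=> ss; have := sublinearD ss x (- x); rewrite subrr sublinear0 //; lra.
Qed.

Lemma sublinear_le s : (forall x y, s (x + y) <= s x + s y) -> s 0 = 0 ->
  (forall t x, 0 < t -> s (io t *: x) <= t * s x) -> sublinear s.
Proof.
move=> sD s0 sZ; split=> // t x; rewrite le_eqVlt => /predU1P[<-|t0].
  by rewrite rmorph0 scale0r s0 mul0r.
apply/eqP; rewrite eq_le sZ //=.
have tV : 0 < t^-1 by rewrite invr_gt0.
have := sZ t^-1 (io t *: x) tV.
by rewrite scalerA -rmorphM mulVf ?gt_eqF // rmorph1 scale1r ler_pdivlMl.
Qed.

Definition slide_set s x y : set R :=
  [set s (y + io t *: x) - t * s x | t in [set t | 0 <= t]].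

(** Sliding in the direction x produces a sublinear functional below s whose
value at - x is at most - s x.  Hence s is linear when nothing sublinear lies
strictly below it; and a linear functional below [slide q x0] must agree with q
at x0. *)
Definition slide s x y : R := inf (slide_set s x y).

Lemma le_slide s x y m :
  (forall t, 0 <= t -> m <= s (y + io t *: x) - t * s x) -> m <= slide s x y.
Proof.
move=> h; apply: lb_le_inf; last by move=> _ [t /= t0 <-]; exact: h.
by exists (s (y + io 0 *: x) - 0 * s x), 0 => /=.
Qed.

Lemma slide_le s x y t : sublinear s -> 0 <= t ->
  slide s x y <= s (y + io t *: x) - t * s x.
Proof.
move=> ss t0; apply: ge_inf; last by exists t.
exists (- s (- y)) => _ [r /= r0 <-].
have := sublinearD ss (y + io r *: x) (- y).
by rewrite addrAC subrr add0r sublinearZ //; lra.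
Qed.

Lemma slide_le_id s x y : sublinear s -> slide s x y <= s y.
Proof.
move=> ss; apply: le_trans (slide_le _ _ ss (lexx 0)) _.
by rewrite rmorph0 scale0r addr0 mul0r subr0.
Qed.

Lemma slideN s x : sublinear s -> slide s x (- x) <= - s x.
Proof.
move=> ss; apply: le_trans (slide_le _ _ ss ler01) _.
by rewrite rmorph1 scale1r addNr sublinear0 // mul1r add0r.
Qed.

Lemma slide_sublinear s x : sublinear s -> sublinear (slide s x).
Proof.
move=> ss; apply: sublinear_le => [y z||r y r0].
- rewrite -lerBlDl; apply: le_slide => t t0; rewrite lerBlDl -lerBlDr.
  apply: le_slide => r r0; rewrite lerBlDr.
  apply: le_trans (slide_le _ _ ss (addr_ge0 r0 t0)) _.
  have := sublinearD ss (y + io r *: x) (z + io t *: x).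
  by rewrite addrACA -scalerDl -rmorphD; lra.
- apply/eqP; rewrite eq_le; apply/andP; split.
    by rewrite -(sublinear0 ss); exact: slide_le_id.
  by apply: le_slide => t t0; rewrite add0r sublinearZ // subrr.
- rewrite -ler_pdivrMl //; apply: le_slide => t t0; rewrite ler_pdivrMl //.
  apply: le_trans (slide_le _ _ ss (mulr_ge0 (ltW r0) t0)) _.
  rewrite rmorphM -scalerA -scalerDr sublinearZ ?(ltW r0) //.
  by rewrite mulrBr mulrA.
Qed.

(** Any two members of the chain are comparable, so a bound on s1 x + s2 y may
be checked with the smaller one of s1 and s2. *)
Lemma sublinear_chain_inf q (F : set (V -> R)) : F !=set0 ->
  (forall s, F s -> sublinear s /\ forall x, s x <= q x) ->
  (forall s1 s2, F s1 -> F s2 ->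
    (forall x, s1 x <= s2 x) \/ (forall x, s2 x <= s1 x)) ->
  let m x := inf [set s x | s in F] in
  sublinear m /\ forall s, F s -> forall x, m x <= s x.
Proof.
move=> [s0 Fs0] Fq Ftot m.
have mle s x : F s -> m x <= s x.
  move=> Fs; apply: ge_inf; last by exists s.
  exists (- q (- x)) => _ [r Fr <-]; have [sr rq] := Fq r Fr.
  by apply: le_trans (sublinearN x sr); rewrite lerN2.
have lem x a : (forall s, F s -> a <= s x) -> a <= m x.
  move=> h; apply: lb_le_inf; first by exists (s0 x), s0.
  by move=> _ [s Fs <-]; exact: h.
split; last by move=> s Fs x; exact: mle.
apply: sublinear_le => [x y||t x t0].
- rewrite -lerBlDl; apply: (lem y) => s1 F1; rewrite lerBlDl -lerBlDr.
  apply: (lem x) => s2 F2; rewrite lerBlDr.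
  have [[d1 _] [d2 _]] := ((Fq _ F1).1, (Fq _ F2).1).
  have [le12|le21] := Ftot _ _ F1 F2.
    by apply: le_trans (mle s1 _ F1) (le_trans (d1 _ _) (lerD _ _)).
  by apply: le_trans (mle s2 _ F2) (le_trans (d2 _ _) (lerD _ _)).
- apply/eqP; rewrite eq_le; apply/andP; split.
    by rewrite -(sublinear0 (Fq _ Fs0).1); exact: mle.
  by apply: (lem 0) => s Fs; rewrite (sublinear0 (Fq _ Fs).1).
- rewrite -ler_pdivrMl //; apply: (lem x) => s Fs; rewrite ler_pdivrMl //.
  by rewrite -(sublinearZ (Fq _ Fs).1) ?(ltW t0) //; exact: mle.
Qed.

Lemma minimal_sublinear q : sublinear q -> exists s, [/\ sublinear s,
  forall x, s x <= q x & forall r, sublinear r -> (forall x, r x <= s x) -> r = s].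
Proof.
move=> sq; pose T := {s : V -> R | sublinear s /\ forall x, s x <= q x}.
pose below (s r : T) : bool := `[< forall x, sval r x <= sval s x >].
have [|||A tA|s smin] := @Zorn T below.
- by move=> s; apply/asboolP.
- move=> s1 s2 s3 /asboolP h1 /asboolP h2; apply/asboolP => x.
  exact: le_trans (h2 x) (h1 x).
- move=> [s1 p1] [s2 p2] /asboolP /= h1 /asboolP /= h2; apply: eq_exist.
  apply/funext => x.
  by apply/eqP; rewrite eq_le h1 h2.
- have [A0|] := pselect (A !=set0); last first.
    move=> nA; exists (exist _ q (conj sq (fun=> lexx _))) => s As.
    by case: nA; exists s.
  have [|||sm lem] := @sublinear_chain_inf q [set sval s | s in A].
  + by case: A0 => s As; exists (sval s), s.
  + by move=> _ [s As <-]; exact: (svalP s).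
  + move=> _ _ [s1 A1 <-] [s2 A2 <-].
    by have [/asboolP|/asboolP] := tA s1 s2 A1 A2; [right|left].
  have [s1 A1] := A0.
  have mq x : inf [set s x | s in [set sval s | s in A]] <= q x.
    apply: le_trans ((svalP s1).2 x).
    by apply: (lem (sval s1)); exists s1.
  exists (exist (fun s => sublinear s /\ forall x, s x <= q x) _ (conj sm mq)).
  move=> s As; apply/asboolP => x.
  by apply: (lem (sval s)); exists s.
exists (sval s); have [ss sq'] := svalP s; split=> // r sr rs.
have rq x : r x <= q x := le_trans (rs x) (sq' x).
by rewrite -(smin (exist _ r (conj sr rq))) //; apply/asboolP.
Qed.

Lemma hahn_banach_sublinear q x0 : sublinear q -> exists u : V -> R,
  [/\ forall x y, u (x + y) = u x + u y, forall t x, u (io t *: x) = t * u x,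
      forall x, u x <= q x & u x0 = q x0].
Proof.
move=> sq; have [u [su uq umin]] := minimal_sublinear (slide_sublinear x0 sq).
have uN x : u (- x) = - u x.
  apply/eqP; rewrite eq_le; apply/andP; split; last first.
    by have := sublinearN (- x) su; rewrite opprK.
  rewrite -[X in X (- x)](umin (slide u x)) ?slideN //.
    exact: slide_sublinear.
  by move=> y; exact: slide_le_id.
have uD x y : u (x + y) = u x + u y.
  apply/eqP; rewrite eq_le sublinearD //= -lerBrDr.
  by have := sublinearD su (x + y) (- y); rewrite addrK uN.
exists u; split=> //.
- move=> t x; have [t0|/ltW t0] := leP 0 t; first exact: sublinearZ.
  by rewrite -[t]opprK rmorphN scaleNr uN sublinearZ ?oppr_ge0 // !mulNr.
- by move=> x; exact: le_trans (uq x) (slide_le_id _ _ sq).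
- apply/eqP; rewrite eq_le; apply/andP; split.
    exact: le_trans (uq x0) (slide_le_id _ _ sq).
  by rewrite -lerN2 -uN; exact: le_trans (uq _) (slideN _ sq).
Qed.

End Sublinear.

(** * Real and complex scalars *)

Lemma linear_bundle (K : numFieldType) (V W : lmodType K) (f : V -> W) :
  linear f -> exists F : {linear V -> W}, forall x, F x = f x.
Proof.
move=> fl.
pose F : {linear V -> W} := HB.pack f (GRing.isLinear.Build K V W _ f fl).
by exists F.
Qed.

Lemma functionalZ (K : numFieldType) (V : lmodType K) (f : {linear V -> K^o})
  a x : f (a *: x) = a * f x.
Proof. exact: linearZ. Qed.

(** The features shared by R and R[i], with moduli taken in R so that estimates
are real inequalities.  [modulusD_aligned] is strict convexity of the scalar
field: only scalars of the same argument give equality in the triangle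
inequality. *)
Record scalars (R : realType) (K : numFieldType) := Scalars {
  embed :> {rmorphism R -> K};
  modulus : K -> R;
  embed_modulus : forall a, embed (modulus a) = `|a|;
  ler_embed : {mono embed : r s / r <= s};
  modulusD_aligned : forall a b, modulus (a + b) = modulus a + modulus b ->
    embed (modulus b) * a = embed (modulus a) * b;
  hahn_banach : forall (V : lmodType K) (q : V -> R),
    (forall x y, q (x + y) <= q x + q y) ->
    (forall a x, q (a *: x) = modulus a * q x) ->
    forall x0, exists2 f : {linear V -> K^o},
      forall x, modulus (f x) <= q x & f x0 = embed (q x0) }.

Lemma real_hahn_banach (R : realType) (V : lmodType R) (q : V -> R) :
  (forall x y, q (x + y) <= q x + q y) ->
  (forall a x, q (a *: x) = `|a| * q x) ->
  forall x0, exists2 f : {linear V -> R^o},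
    forall x, `|f x| <= q x & f x0 = q x0.
Proof.
move=> qD qZ x0.
have [u [uD uZ uq ux0]] : exists u : V -> R,
    [/\ forall x y, u (x + y) = u x + u y, forall t x, u (t *: x) = t * u x,
        forall x, u x <= q x & u x0 = q x0].
  apply: (@hahn_banach_sublinear R R idfun V q x0).
  by split=> // t x t0; rewrite qZ ger0_norm.
have [|f fE] := @linear_bundle R V R^o u; first by move=> a x y; rewrite uD uZ.
exists f => [x|]; last by rewrite fE.
rewrite fE ler_norml uq andbT lerNl.
have := uq (- x); rewrite -scaleN1r uZ qZ normrN1 mul1r.
by rewrite mulN1r.
Qed.

Lemma real_modulusD_aligned (R : realType) (a b : R) :
  `|a + b| = `|a| + `|b| -> `|b| * a = `|a| * b.
Proof. by case: (ler0P a); case: (ler0P b); case: (ler0P (a + b)); nra. Qed.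

Definition real_scalars (R : realType) : scalars R R :=
  @Scalars R R idfun (fun a => `|a|) (fun=> erefl) (fun _ _ => erefl)
    (@real_modulusD_aligned R) (@real_hahn_banach R).

(** The real part u of a complex functional determines it as
x |-> u x - i u (i x), and rotating x so that f x becomes nonnegative turns a
bound on u into the same bound on |f|. *)
Lemma complex_hahn_banach (R : realType) (V : lmodType R[i]) (q : V -> R) :
  (forall x y, q (x + y) <= q x + q y) ->
  (forall a x, q (a *: x) = complex.Re `|a| * q x) ->
  forall x0, exists2 f : {linear V -> R[i]^o},
    forall x, complex.Re `|f x| <= q x & f x0 = (q x0)%:C%C.
Proof.
move=> qD qZ x0.
have [u [uD uZ uq ux0]] : exists u : V -> R,
    [/\ forall x y, u (x + y) = u x + u y,
        forall t x, u (t%:C%C *: x) = t * u x,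
        forall x, u x <= q x & u x0 = q x0].
  apply: (@hahn_banach_sublinear R R[i] (real_complex R) V q x0).
  by split=> // t x t0; rewrite qZ ger0_norm // lecR.
have [|f fE] := @linear_bundle R[i] V R[i]^o
    (fun x => (Complex (u x) (- u (Complex 0 1 *: x)))).
  move=> [r s] x y.
  have cE : Complex r s = r%:C%C + s%:C%C * Complex 0 1.
    by apply/eqP; rewrite eq_complex /=; apply/andP; split; apply/eqP; ring.
  have iE : Complex 0 1 * Complex r s = r%:C%C * Complex 0 1 + (- s)%:C%C.
    by apply/eqP; rewrite eq_complex /=; apply/andP; split; apply/eqP; ring.
  rewrite scalerDr scalerA iE {1}cE !scalerDl -!scalerA !uD !uZ.
  by apply/eqP; rewrite eq_complex /=; apply/andP; split; apply/eqP; ring.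
have fq x : complex.Re `|f x| <= q x.
  have [->|nz] := eqVneq (f x) 0.
    rewrite normr0 /=; have := qD x (- x).
    rewrite subrr -scaleN1r -{1}(scale0r 0) !qZ normr0 normrN1 /=; lra.
  pose l := `|f x| / f x.
  have l1 : complex.Re `|l| = 1 by rewrite normf_div normr_id divff ?normr_eq0.
  have := uq (l *: x); rewrite qZ l1 mul1r; apply: le_trans.
  have : f (l *: x) = `|f x| by rewrite functionalZ /l divfK.
  by rewrite fE => <-.
exists f => //.
(* The real part of f x0 is q x0 already and |f x0| <= q x0, so that there is
   no room for an imaginary part. *)
have /= fx0 := fE x0; rewrite ux0 in fx0.
have := fq x0; rewrite fx0 normc_def /= => h.
have q0 : 0 <= q x0 := le_trans (sqrtr_ge0 _) h.
have {}h : q x0 ^+ 2 + (- u (Complex 0 1 *: x0)) ^+ 2 <= q x0 ^+ 2.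
  rewrite -ler_sqrt ?sqr_ge0 // [leRHS]sqrtr_sqr ger0_norm //.
have /eqP : (- u (Complex 0 1 *: x0)) ^+ 2 = 0.
  by apply/eqP; rewrite eq_le sqr_ge0 andbT; lra.
by rewrite sqrf_eq0 => /eqP ->.
Qed.

Lemma complex_modulusE (R : realType) (a : R[i]) :
  (complex.Re `|a|)%:C%C = `|a|.
Proof. by rewrite normc_def. Qed.

Lemma complex_modulusD_aligned (R : realType) (a b : R[i]) :
  complex.Re `|a + b| = complex.Re `|a| + complex.Re `|b| ->
  (complex.Re `|b|)%:C%C * a = (complex.Re `|a|)%:C%C * b.
Proof.
move=> h; rewrite !complex_modulusE.
have /normCDeq[t t1 [-> ->]] : `|a + b| = `|a| + `|b|.
  by rewrite -complex_modulusE h rmorphD /= !complex_modulusE.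
have nE c : `| `|c| * t | = `|c| :> R[i] by rewrite normrM normr_id (eqP t1) mulr1.
by rewrite !nE; ring.
Qed.

Definition complex_scalars (R : realType) : scalars R R[i] :=
  @Scalars R R[i] (real_complex R) (fun a => complex.Re `|a|)
    (@complex_modulusE R) (@lecR R) (@complex_modulusD_aligned R)
    (@complex_hahn_banach R).

Section ScalarTheory.
Variables (R : realType) (K : numFieldType) (S : scalars R K).
Implicit Types (a b : K) (r s : R).
Local Notation mod := (modulus S).

Lemma ltr_embed r s : (S r < S s) = (r < s).
Proof. exact: (leW_mono (ler_embed S)). Qed.

Lemma embed_inj : injective S.
Proof. exact: (inc_inj (ler_embed S)). Qed.

Lemma modulus_ge0 a : 0 <= mod a.
Proof. by rewrite -(ler_embed S) rmorph0 embed_modulus. Qed.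

Lemma ger0_embed a : 0 <= a -> S (mod a) = a.
Proof. by move=> a0; rewrite embed_modulus ger0_norm. Qed.

Lemma modulus_embed r : 0 <= r -> mod (S r) = r.
Proof.
move=> r0; apply: embed_inj; rewrite ger0_embed //.
by rewrite -(rmorph0 S) ler_embed.
Qed.

Lemma modulus0 : mod 0 = 0.
Proof. by rewrite -(rmorph0 S) modulus_embed. Qed.

Lemma modulus1 : mod 1 = 1.
Proof. by rewrite -(rmorph1 S) modulus_embed. Qed.

Lemma modulus_nat n : mod n%:R = n%:R.
Proof. by rewrite -(rmorph_nat S) modulus_embed. Qed.

Lemma modulusN a : mod (- a) = mod a.
Proof. by apply: embed_inj; rewrite !embed_modulus normrN. Qed.

Lemma modulusM a b : mod (a * b) = mod a * mod b.
Proof. by apply: embed_inj; rewrite rmorphM !embed_modulus normrM. Qed.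

Lemma modulusV a : mod a^-1 = (mod a)^-1.
Proof. by apply: embed_inj; rewrite fmorphV !embed_modulus normfV. Qed.

Lemma modulusD a b : mod (a + b) <= mod a + mod b.
Proof. by rewrite -(ler_embed S) rmorphD !embed_modulus ler_normD. Qed.

Lemma modulusB a b : mod (a - b) <= mod a + mod b.
Proof. by have := modulusD a (- b); rewrite modulusN. Qed.

Lemma modulus_eq0 a : (mod a == 0) = (a == 0).
Proof. by rewrite -(inj_eq embed_inj) rmorph0 embed_modulus normr_eq0. Qed.

Lemma modulus_gt0 a : (0 < mod a) = (a != 0).
Proof. by rewrite lt_neqAle modulus_ge0 andbT eq_sym modulus_eq0. Qed.

Lemma modulus_norm a : mod `|a| = mod a.
Proof. by apply: embed_inj; rewrite !embed_modulus normr_id. Qed.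

Lemma exists_phase a : exists c, mod c = 1 /\ a = c * S (mod a).
Proof.
have [->|a0] := eqVneq a 0.
  by exists 1; rewrite modulus1 modulus0 rmorph0 mulr0.
exists (a / S (mod a)); rewrite divfK ?embed_modulus ?normr_eq0 //; split=> //.
by apply: embed_inj; rewrite !embed_modulus rmorph1 normf_div normr_id divff ?normr_eq0.
Qed.

(** R[i] is not totally ordered, but nonnegative scalars and the upper bounds of
a nonempty set of them lie in the image of R, where suprema exist. *)
Lemma supremum_lub (A : set K) (M : K) : A !=set0 -> (forall a, A a -> 0 <= a) ->
  ubound A M ->
  ubound A (supremum 0 A) /\ forall M', ubound A M' -> supremum 0 A <= M'.
Proof.
move=> A0 Age Aub; have [a0 Aa0] := A0.
suff : supremums A !=set0.
  rewrite /supremum; case: eqP => [e|_]; first by rewrite e in Aa0.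
  by move=> [l ll]; have [] := @xgetPex _ 0 _ (ex_intro _ l ll).
have mod_ub b : ubound A b -> 0 <= b /\ ubound (mod @` A) (mod b).
  move=> bub; have b0 : 0 <= b := le_trans (Age _ Aa0) (bub _ Aa0).
  split=> // _ [a Aa <-]; rewrite -(ler_embed S) !ger0_embed //.
    exact: bub.
  exact: Age.
exists (S (sup (mod @` A))); split.
  move=> a Aa; rewrite -(ger0_embed (Age _ Aa)) ler_embed.
  apply: ub_le_sup; last by exists a.
  by exists (mod M); exact: (mod_ub _ Aub).2.
move=> b /mod_ub[b0 bub]; rewrite -(ger0_embed b0) ler_embed.
by apply: ge_sup => //; exists (mod a0), a0.
Qed.

End ScalarTheory.

(** * Operator norm, states and numerical radius *)

Record seminorm (R : realType) (K : numFieldType) (S : scalars R K)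
    (V : lmodType K) (q : V -> R) : Prop := Seminorm {
  seminormD : forall x y, q (x + y) <= q x + q y;
  seminormZ : forall a x, q (a *: x) = modulus S a * q x }.

Section SeminormTheory.
Variables (R : realType) (K : numFieldType) (S : scalars R K).
Variables (V : lmodType K) (q : V -> R).
Hypothesis qS : seminorm S q.

Lemma seminorm0 : q 0 = 0.
Proof. by rewrite -(scale0r 0) (seminormZ qS) modulus0 mul0r. Qed.

Lemma seminormN x : q (- x) = q x.
Proof. by rewrite -scaleN1r (seminormZ qS) modulusN modulus1 mul1r. Qed.

Lemma seminormB x y : q (x - y) <= q x + q y.
Proof. by have := seminormD qS x (- y); rewrite seminormN. Qed.

Lemma seminorm_ge0 x : 0 <= q x.
Proof. by have := seminormB x x; rewrite subrr seminorm0; lra. Qed.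

End SeminormTheory.

Section NumericalRadius.
Variables (R : realType) (K : numFieldType) (S : scalars R K).
Variable Y : normedModType K.
Local Notation mod := (modulus S).

Definition real_norm (X : normedModType K) (x : X) : R := mod `|x|.
Local Notation nm := (@real_norm _).

Lemma embed_norm (X : normedModType K) (x : X) : S (nm x) = `|x|.
Proof. exact: ger0_embed. Qed.

Lemma real_norm_seminorm (X : normedModType K) : seminorm S (@real_norm X).
Proof.
split=> [x y|a x]; last first.
  by apply: (@embed_inj _ _ S); rewrite rmorphM !embed_norm normrZ embed_modulus.
by rewrite -(ler_embed S) rmorphD !embed_norm ler_normD.
Qed.

Lemma real_norm_eq0 (X : normedModType K) (x : X) : (nm x == 0) = (x == 0).
Proof. by rewrite modulus_eq0 normr_eq0. Qed.

Lemma bounded_opP (X Z : normedModType K) (T : X -> Z) : bounded_op T ->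
  exists2 M : R, 0 <= M & forall x, nm (T x) <= M * nm x.
Proof.
move=> [M TM]; exists (mod M) => [|x]; first exact: modulus_ge0.
have [x0|x0] := eqVneq x 0.
  have := TM x; rewrite x0 normr0 mulr0 normr_le0 => /eqP ->.
  by rewrite (seminorm0 (real_norm_seminorm _)) mulr_ge0 ?modulus_ge0.
rewrite -(ler_embed S) rmorphM !embed_norm ger0_embed ?TM //.
by rewrite -(@pmulr_lge0 _ `|x|) ?normr_gt0 // (le_trans _ (TM x)).
Qed.

Lemma bounded_opI (X Z : normedModType K) (T : X -> Z) (M : R) :
  (forall x, nm (T x) <= M * nm x) -> bounded_op T.
Proof.
move=> TM; exists (S M) => x.
by rewrite -!embed_norm -rmorphM ler_embed.
Qed.

Lemma op_norm_lub (X Z : normedModType K) (T : X -> Z) : bounded_op T ->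
  (forall x, `|x| <= 1 -> `|T x| <= op_norm T) /\
  (forall M, (forall x, `|x| <= 1 -> `|T x| <= M) -> op_norm T <= M).
Proof.
move=> /bounded_opP[M M0 TM].
have [|||ub lub] := @supremum_lub _ _ S
    [set `|T x| | x in [set x : X | `|x| <= 1]] (S M).
- by exists `|T 0|, 0 => //=; rewrite normr0.
- by move=> _ [x _ <-].
- move=> _ [x /= x1 <-]; rewrite -embed_norm ler_embed (le_trans (TM x)) //.
  by rewrite ler_piMr // -(ler_embed S) embed_norm rmorph1.
split=> [x x1|N TN]; first by apply: ub; exists x.
by apply: lub => _ [x x1 <-]; exact: TN.
Qed.

Lemma le_op_norm (X Z : normedModType K) (T : {linear X -> Z}) x :
  bounded_op T -> `|T x| <= op_norm T * `|x|.
Proof.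
move=> bT; have [->|x0] := eqVneq x 0; first by rewrite linear0 !normr0 mulr0.
have nx : `| `|x|^-1 *: x | <= 1.
  by rewrite normrZ normfV normr_id mulVf ?normr_eq0.
have := (op_norm_lub bT).1 _ nx.
by rewrite linearZ normrZ normfV normr_id ler_pdivrMl ?normr_gt0 // mulrC.
Qed.

Lemma Pi_setP (x : Y) (f : {linear Y -> K^o}) : Pi_set (x, f) <->
  [/\ nm x = 1, forall y, mod (f y) <= nm y & f x = 1].
Proof.
split=> [[/= x1 bf f1 fx]|[x1 bf fx]].
  split=> //; first by rewrite /real_norm x1 modulus1.
  move=> y; rewrite -(ler_embed S) embed_modulus embed_norm.
  by have := le_op_norm y bf; rewrite f1 mul1r.
have xn : `|x| = 1 by rewrite -embed_norm x1 rmorph1.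
have bdf : bounded_op f.
  by apply: (@bounded_opI _ _ _ 1) => y; rewrite mul1r /real_norm modulus_norm; exact: bf.
split=> //=; apply/eqP; rewrite eq_le; apply/andP; split.
  apply: (op_norm_lub bdf).2 => y; apply: le_trans.
  by have := bf y; rewrite -(ler_embed S) embed_modulus embed_norm.
have := (op_norm_lub bdf).1 x; rewrite xn fx normr1; exact.
Qed.

Definition real_radius (T : Y -> Y) : R := mod (num_radius T).

Lemma num_radius_lub (T : Y -> Y) : bounded_op T ->
  (exists z, @Pi_set K Y z) ->
  [/\ num_radius T = S (real_radius T),
    forall x f, Pi_set (x, f) -> mod (f (T x)) <= real_radius T &
    forall M, (forall x f, Pi_set (x, f) -> mod (f (T x)) <= M) ->
      real_radius T <= M].
Proof.
move=> /bounded_opP[M M0 TM] [z zP].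
have [|||ub lub] := @supremum_lub _ _ S
    [set `|z.2 (T z.1)| | z in @Pi_set K Y] (S M).
- by exists `|z.2 (T z.1)|, z.
- by move=> _ [x _ <-].
- move=> _ [[x f] /Pi_setP[/= x1 fy fx] <-].
  rewrite -[leLHS](embed_modulus S) ler_embed (le_trans (fy _)) //.
  by rewrite (le_trans (TM x)) // x1 mulr1.
have v0 : 0 <= num_radius T by apply: le_trans (ub `|z.2 (T z.1)| _) => //; exists z.
have vE : num_radius T = S (real_radius T) by rewrite ger0_embed.
split=> // [x f xf|N TN].
  by rewrite -(ler_embed S) -vE embed_modulus; apply: ub; exists (x, f).
rewrite -(ler_embed S) -vE; apply: lub => _ [[x f] xf <-] /=.
by rewrite -[leLHS](embed_modulus S) ler_embed; exact: TN.
Qed.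

End NumericalRadius.

(** The weak property asks for every positive e, the strong one only for e < 1;
1/2 stands in for larger e, which is comparable with 1 also in R[i]. *)
Lemma BPBp_nu_weak (R : realType) (K : numFieldType) (S : scalars R K)
  (Y : normedModType K) : BPBp_nu Y -> weak_BPBp_nu Y.
Proof.
move=> B e e0.
have [d [d0 d1 de]] : exists d : K, [/\ 0 < d, d < 1 & d <= e].
  have [lt1|le1] := real_ltP (gtr0_real e0) (real1 K); first by exists e.
  exists 2^-1; split; [by rewrite invr_gt0|by rewrite invf_lt1 ?ltr1n|].
  by rewrite (le_trans _ le1) // invf_le1 // ler1n.
have [eta [eta0 h]] := B d d0 d1; exists eta; split=> // T x f bT xf T1 Tx.
have [U [y [g [bU yg [v1 v2] UT [xy fg]]]]] := h T x f bT xf T1 Tx.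
exists U, y, g; split=> //; last by split; apply: lt_le_trans de.
apply: lt_le_trans de; rewrite [X in X < _](_ : _ = op_norm (T \- U)) //.
congr (supremum 0 _); apply/seteqP.
by split=> _ [z z1 <-]; exists z => //=; rewrite distrC.
Qed.

(** * Spaces with an l1-plane as a summand *)

(** Y is the l1-sum of the plane spanned by e1, e2 and of the common kernel of
a1 and a2 with norm q; here q is a seminorm on all of Y that vanishes on the
plane.  The last two fields make q strictly convex where a3 is not zero, and
almost flat around e3 in some direction. *)
Record l1_plane_sum (R : realType) (K : numFieldType) (S : scalars R K)
    (Y : normedModType K) (q : Y -> R) (a1 a2 a3 : {linear Y -> K^o})
    (e1 e2 e3 : Y) : Prop := L1PlaneSum {
  sum_seminorm : seminorm S q;
  sum_normE : forall x,
    real_norm S x = modulus S (a1 x) + modulus S (a2 x) + q x;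
  sum_dual : [/\ a1 e1 = 1, a2 e1 = 0, a1 e2 = 0 & a2 e2 = 1];
  sum_kernel : [/\ q e1 = 0, q e2 = 0, a1 e3 = 0 & a2 e3 = 0];
  sum_a3 : [/\ a3 e3 = 1, q e3 = 2 & forall x, 2 * modulus S (a3 x) <= q x];
  sum_strict : forall u v, q u = 1 -> q v = 1 -> 2 <= q (u + v) ->
    q (a3 v *: u - a3 u *: v) = 0;
  sum_flat : forall eta : R, 0 < eta -> exists z,
    [/\ a1 z = 0, a2 z = 0, a3 z = 0, 1 <= q z &
        q (e3 + z) <= 2 + eta /\ q (e3 - z) <= 2 + eta] }.

Section FailureOfWeakBPBp.
Variables (R : realType) (K : numFieldType) (S : scalars R K).
Variables (Y : normedModType K) (q : Y -> R) (a1 a2 a3 : {linear Y -> K^o}).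
Variables (e1 e2 e3 : Y).
Hypothesis H : l1_plane_sum S q a1 a2 a3 e1 e2 e3.
Local Notation mod := (modulus S).
Local Notation nm := (real_norm S).
Local Notation qS := (sum_seminorm H).

Let a1e1 : a1 e1 = 1. Proof. by case: (sum_dual H). Qed.
Let a2e1 : a2 e1 = 0. Proof. by case: (sum_dual H). Qed.
Let a1e2 : a1 e2 = 0. Proof. by case: (sum_dual H). Qed.
Let a2e2 : a2 e2 = 1. Proof. by case: (sum_dual H). Qed.
Let a1e3 : a1 e3 = 0. Proof. by case: (sum_kernel H). Qed.
Let a2e3 : a2 e3 = 0. Proof. by case: (sum_kernel H). Qed.
Let qe1 : q e1 = 0. Proof. by case: (sum_kernel H). Qed.
Let qe2 : q e2 = 0. Proof. by case: (sum_kernel H). Qed.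

Definition off_plane x : Y := x - (a1 x *: e1 + a2 x *: e2).

Lemma off_planeE x : x = a1 x *: e1 + a2 x *: e2 + off_plane x.
Proof. by rewrite /off_plane addrC subrK. Qed.

Lemma off_planeB x y : off_plane (x - y) = off_plane x - off_plane y.
Proof.
by rewrite /off_plane !linearB /= !scalerBl addrACA -opprD [RHS]addrACA -opprD.
Qed.

Lemma q_plane a b : q (a *: e1 + b *: e2) = 0.
Proof.
apply/eqP; rewrite eq_le (seminorm_ge0 qS) andbT.
apply: le_trans (seminormD qS _ _) _.
by rewrite !(seminormZ qS) qe1 qe2 !mulr0 addr0.
Qed.

Lemma q_off_plane x : q (off_plane x) = q x.
Proof.
apply/eqP; rewrite eq_le; apply/andP; split.
  by have := seminormB qS x (a1 x *: e1 + a2 x *: e2); rewrite q_plane addr0.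
have := seminormD qS (a1 x *: e1 + a2 x *: e2) (off_plane x).
by rewrite -off_planeE q_plane add0r.
Qed.

Lemma a1_off_plane x : a1 (off_plane x) = 0.
Proof.
by rewrite /off_plane linearB linearD !functionalZ a1e1 a1e2 mulr1 mulr0 addr0 subrr.
Qed.

Lemma a2_off_plane x : a2 (off_plane x) = 0.
Proof.
by rewrite /off_plane linearB linearD !functionalZ a2e1 a2e2 mulr1 mulr0 add0r subrr.
Qed.

Lemma norm_kernel x : a1 x = 0 -> a2 x = 0 -> nm x = q x.
Proof. by move=> h1 h2; rewrite (sum_normE H) h1 h2 modulus0 !add0r. Qed.

Lemma norm_off_plane x : nm (off_plane x) = q x.
Proof. by rewrite norm_kernel ?a1_off_plane ?a2_off_plane ?q_off_plane. Qed.

Lemma q_le_norm x : q x <= nm x.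
Proof. by rewrite (sum_normE H) lerDr addr_ge0 ?modulus_ge0. Qed.

Lemma a1_le_norm x : mod (a1 x) <= nm x.
Proof.
by rewrite (sum_normE H) -addrA lerDl addr_ge0 ?modulus_ge0 // (seminorm_ge0 qS).
Qed.

Lemma a2_le_norm x : mod (a2 x) <= nm x.
Proof.
by rewrite (sum_normE H) addrAC lerDr addr_ge0 ?modulus_ge0 // (seminorm_ge0 qS).
Qed.

Lemma norm_e1 : nm e1 = 1.
Proof. by rewrite (sum_normE H) a1e1 a2e1 qe1 modulus0 modulus1 !addr0. Qed.

Lemma norm_e2 : nm e2 = 1.
Proof. by rewrite (sum_normE H) a1e2 a2e2 qe2 modulus0 modulus1 addr0 add0r. Qed.

Section Attainment.
Variable T : {linear Y -> Y}.
Hypothesis bT : bounded_op T.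
Hypothesis Pi0 : exists z, @Pi_set K Y z.
Local Notation v := (real_radius S T).
Local Notation contraction g := (forall x, mod (g x) <= nm x).

(** Up to scaling, (x, g) is a state. *)
Lemma radius_ge (g : {linear Y -> K^o}) x : contraction g ->
  mod (g x) = nm x -> mod (g (T x)) <= v * nm x.
Proof.
move=> gc gx; have [x0|x0] := eqVneq (nm x) 0.
  have /eqP xe : x == 0 by rewrite -(real_norm_eq0 S) x0.
  by rewrite x0 mulr0 xe !linear0 modulus0.
have gx0 : g x != 0 by rewrite -(modulus_eq0 S) gx.
have [_ /(_ ((g x)^-1 *: x) g) ub _] := num_radius_lub S bT Pi0.
move: ub; rewrite linearZ functionalZ modulusM modulusV gx ler_pdivrMl.
  rewrite mulrC; apply; apply/(Pi_setP S); split=> //.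
    by rewrite (seminormZ (real_norm_seminorm S Y)) modulusV gx mulVf.
  by rewrite functionalZ mulVf.
by rewrite lt_neqAle eq_sym x0 (seminorm_ge0 (real_norm_seminorm S Y)).
Qed.

(** Both 1 = g y and v = |g (T y)| split along y = a1 y e1 + a2 y e2 + y'.  No
summand can exceed its share |a1 y|, |a2 y|, q y (times v in the second case),
so each of them attains it. *)
Lemma attaining_vertices y (g : {linear Y -> K^o}) :
  Pi_set (y, g) -> a1 y != 0 -> a2 y != 0 -> v = mod (g (T y)) ->
  [/\ mod (g e1) = 1, mod (g (T e1)) = v, mod (g e2) = 1 & mod (g (T e2)) = v].
Proof.
move=> /(Pi_setP S)[y1 gc gy]; rewrite -!(modulus_gt0 S) => a1y a2y vE.
have modD3 (a b c : K) : mod (a + b + c) <= mod a + mod b + mod c.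
  by apply: le_trans (modulusD _ _ _) _; rewrite lerD2r modulusD.
have n1 := sum_normE H y; rewrite y1 in n1.
have g1 := gc e1; rewrite norm_e1 in g1.
have g2 := gc e2; rewrite norm_e2 in g2.
have g3 := gc (off_plane y); rewrite norm_off_plane in g3.
have m1 : 1 <= mod (a1 y) * mod (g e1) + mod (a2 y) * mod (g e2)
               + mod (g (off_plane y)).
  rewrite -(modulus1 S) -gy {1}(off_planeE y) !linearD /= !functionalZ.
  by rewrite -!modulusM.
have [ge1 ge2] : mod (g e1) = 1 /\ mod (g e2) = 1 by split; nra.
have ge3 : mod (g (off_plane y)) = nm (off_plane y).
  by rewrite norm_off_plane; nra.
have := radius_ge gc ge3; rewrite norm_off_plane => t3.
have := @radius_ge g e1 gc; rewrite norm_e1 => /(_ ge1); rewrite mulr1 => t1.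
have := @radius_ge g e2 gc; rewrite norm_e2 => /(_ ge2); rewrite mulr1 => t2.
have m2 : v <= mod (a1 y) * mod (g (T e1)) + mod (a2 y) * mod (g (T e2))
               + mod (g (T (off_plane y))).
  rewrite vE {1}(off_planeE y) !linearD ![T (_ *: _)]linearZ /= !functionalZ.
  by rewrite -!modulusM.
have m3 : v = v * mod (a1 y) + v * mod (a2 y) + v * q y.
  by rewrite -!mulrDr -n1 mulr1.
by split=> //; nra.
Qed.

(** Replacing g on the summand Y by any functional phi with |phi| <= q leaves it
a state at x.  With phi norming the Y-component of T x, and its phase chosen to
add up with the plane component s, the bound |s| + q w <= v = |s + g w|
results. *)
Lemma off_plane_normed (g : {linear Y -> K^o}) x : contraction g ->
  nm x = 1 -> q x = 0 -> mod (g x) = 1 -> mod (g (T x)) = v ->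
  mod (g (off_plane (T x))) = q (off_plane (T x)).
Proof.
move=> gc x1 qx gx gTx; set w := off_plane (T x).
have [phi phiq phiw] := hahn_banach (seminormD qS) (seminormZ qS) w.
have phi0 z : q z = 0 -> phi z = 0.
  move=> qz; apply/eqP; rewrite -(modulus_eq0 S) eq_le modulus_ge0 andbT.
  by rewrite -qz.
pose s := a1 (T x) * g e1 + a2 (T x) * g e2.
have [c [c1 cs]] := exists_phase S s.
have [|h hE] := @linear_bundle K Y K^o
    (fun z => a1 z * g e1 + a2 z * g e2 + c * phi z).
  by move=> k y z; rewrite -[RHS]/(k * _ + _) !linearD /= !functionalZ; ring.
have hc : contraction h.
  move=> z; rewrite hE (sum_normE H).
  apply: le_trans (modulusD _ _ _) (lerD _ _); last first.
    by rewrite modulusM c1 mul1r.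
  apply: le_trans (modulusD _ _ _) (lerD _ _).
    by rewrite modulusM ler_piMr ?modulus_ge0 // -norm_e1.
  by rewrite modulusM ler_piMr ?modulus_ge0 // -norm_e2.
have gE z : g z = a1 z * g e1 + a2 z * g e2 + g (off_plane z).
  by rewrite {1}(off_planeE z) !linearD /= !functionalZ.
have hx : h x = g x.
  rewrite hE (gE x) (phi0 _ qx) mulr0; congr (_ + _).
  apply/esym/eqP; rewrite -(modulus_eq0 S) eq_le modulus_ge0 andbT.
  by apply: le_trans (gc _) _; rewrite norm_off_plane qx.
have hTx : h (T x) = c * S (mod s + q w).
  have -> : h (T x) = s + c * phi (T x) by rewrite hE.
  rewrite {1}cs rmorphD mulrDr -phiw; congr (_ + _ * _).
  by rewrite {1}(off_planeE (T x)) linearD (phi0 _ (q_plane _ _)) add0r.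
have := radius_ge hc (_ : mod (h x) = nm x); rewrite hx x1 => /(_ gx).
rewrite hTx modulusM c1 mul1r mulr1 modulus_embed; last first.
  by rewrite addr_ge0 ?modulus_ge0 // (seminorm_ge0 qS).
rewrite -gTx (gE (T x)) => le1; have le2 := modulusD S s (g w).
have := gc w; rewrite norm_off_plane -(q_off_plane (T x)) -/w => le3.
by apply/eqP; rewrite eq_le le3 /=; move: (le_trans le1 le2); rewrite lerD2l.
Qed.

End Attainment.

(** Dividing u and w by the values of g gives two unit vectors whose sum has
norm 2, whatever the arguments of g u and g w are; the conclusion is
insensitive to these scalings. *)
Lemma normed_pair_aligned (g : {linear Y -> K^o}) u w :
  (forall x, mod (g x) <= nm x) ->
  a1 u = 0 -> a2 u = 0 -> a1 w = 0 -> a2 w = 0 ->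
  mod (g u) = q u -> mod (g w) = q w -> q u != 0 -> q w != 0 ->
  q (a3 w *: u - a3 u *: w) = 0.
Proof.
move=> gc u1 u2 w1 w2 gu gw u0 w0.
have gu0 : g u != 0 by rewrite -(modulus_eq0 S) gu.
have gw0 : g w != 0 by rewrite -(modulus_eq0 S) gw.
have qu : q ((g u)^-1 *: u) = 1 by rewrite (seminormZ qS) modulusV gu mulVf.
have qw : q ((g w)^-1 *: w) = 1 by rewrite (seminormZ qS) modulusV gw mulVf.
have q2 : 2 <= q ((g u)^-1 *: u + (g w)^-1 *: w).
  rewrite -norm_kernel ?linearD /= ?functionalZ ?u1 ?u2 ?w1 ?w2 ?mulr0 ?addr0 //.
  apply: le_trans (gc _); rewrite linearD /= !functionalZ !mulVf //.
  by rewrite -(rmorph1 S) -rmorphD modulus_embed ?addr_ge0.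
have := sum_strict H qu qw q2; rewrite !functionalZ !scalerA.
rewrite (_ : _ - _ = ((g u)^-1 * (g w)^-1) *: (a3 w *: u - a3 u *: w)).
  rewrite (seminormZ qS) modulusM !modulusV gu gw => /eqP.
  by rewrite !mulf_eq0 !invr_eq0 (negPf u0) (negPf w0) => /eqP.
rewrite scalerBr !scalerA; congr (_ *: _ - _ *: _); ring.
Qed.


(** If U did attain its numerical radius there, the Y-components u, w of U e1,
U e2 would satisfy a3 w u = a3 u w.  They lie within 1/100 of k (e3 + z) and
k (e3 - z), and for these two vectors the difference is 2 k^2 z, of norm at
least 2/9. *)
Lemma far_from_attaining (k : K) (z : Y) (T U : {linear Y -> Y}) y
    (g : {linear Y -> K^o}) :
  a1 z = 0 -> a2 z = 0 -> a3 z = 0 -> 1 <= q z ->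
  q (e3 + z) <= 3 -> q (e3 - z) <= 3 ->
  3^-1 <= mod k <= 2^-1 ->
  T e1 = k *: (e3 + z) -> T e2 = k *: (e3 - z) ->
  bounded_op U -> (forall x, nm x = 1 -> nm (U x - T x) <= 100^-1) ->
  Pi_set (y, g) -> a1 y != 0 -> a2 y != 0 ->
  real_radius S U <> mod (g (U y)).
Proof.
move=> z1 z2 z3 qz qp qm /andP[k3 k2] Te1 Te2 bU UT yg a1y a2y vE.
have Pi0 : exists w, @Pi_set K Y w by exists (y, g).
have [ge1 gU1 ge2 gU2] := attaining_vertices bU Pi0 yg a1y a2y vE.
have [_ gc _] := (Pi_setP S _ _).1 yg.
have a3q x : mod (a3 x) <= 2^-1 * q x.
  by have [_ _ /(_ x)] := sum_a3 H; lra.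
have a3e3 : a3 e3 = 1 by case: (sum_a3 H).
pose u := off_plane (U e1); pose w := off_plane (U e2).
pose r := u - T e1; pose t := w - T e2.
have fixT x : a1 x = 0 -> a2 x = 0 -> off_plane x = x.
  by move=> x1 x2; rewrite /off_plane x1 x2 !scale0r addr0 subr0.
have off e x : a1 x = 0 -> a2 x = 0 -> T e = x -> nm e = 1 ->
    q (off_plane (U e) - T e) <= 100^-1.
  move=> x1 x2 Te en; rewrite -{1}(fixT (T e)) ?Te // -Te -off_planeB q_off_plane.
  exact: le_trans (q_le_norm _) (UT _ en).
have qr : q r <= 100^-1.
  apply: off Te1 norm_e1; rewrite functionalZ linearD;
  by rewrite ?a1e3 ?a2e3 ?z1 ?z2 addr0 mulr0.
have qt : q t <= 100^-1.
  apply: off Te2 norm_e2; rewrite functionalZ linearB;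
  by rewrite ?a1e3 ?a2e3 ?z1 ?z2 subr0 mulr0.
have uE : u = k *: (e3 + z) + r by rewrite /r Te1 addrC subrK.
have wE : w = k *: (e3 - z) + t by rewrite /t Te2 addrC subrK.
have a3u : a3 u = k + a3 r.
  by rewrite uE linearD functionalZ linearD a3e3 z3 addr0 mulr1.
have a3w : a3 w = k + a3 t.
  by rewrite wE linearD functionalZ linearB a3e3 z3 subr0 mulr1.
have kp : 0 < mod k by lra.
have nz d p : mod d <= 200^-1 -> a3 p = k + d -> q p != 0.
  move=> d1 ap; have := modulusB S (k + d) d; rewrite addrK -ap => h.
  by have aq := a3q p; rewrite gt_eqF //; lra.
have ar : mod (a3 r) <= 200^-1 by have := a3q r; lra.
have at_ : mod (a3 t) <= 200^-1 by have := a3q t; lra.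
have D0 : q (a3 w *: u - a3 u *: w) = 0.
  apply: (normed_pair_aligned gc); rewrite ?a1_off_plane ?a2_off_plane //.
  - exact (off_plane_normed bU Pi0 gc norm_e1 qe1 ge1 gU1).
  - exact (off_plane_normed bU Pi0 gc norm_e2 qe2 ge2 gU2).
  - exact: nz ar a3u.
  - exact: nz at_ a3w.
(* The product a3 w u differs little from its unperturbed value k^2 (e3 + z);
   est bounds the difference, for both products at once. *)
have est d p x : mod d <= 200^-1 -> q x <= 100^-1 -> q p <= 3 ->
    q ((k + d) *: (k *: p + x) - (k * k) *: p) <= 30^-1.
  move=> d1 x1 p3; have -> : (k + d) *: (k *: p + x) - (k * k) *: p =
      (d * k) *: p + (k + d) *: x.
    by rewrite scalerDr scalerA addrAC -scalerBl mulrDl addrAC subrr add0r.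
  apply: le_trans (seminormD qS _ _) _; rewrite !(seminormZ qS) modulusM.
  have := modulusD S k d; have := modulus_ge0 S d.
  have := seminorm_ge0 qS x; have := seminorm_ge0 qS p => p0 x0 d0 kd.
  have dk : mod d * mod k <= 200^-1 * 2^-1 by rewrite ler_pM // ltW.
  have : mod d * mod k * q p <= 200^-1 * 2^-1 * 3.
    by rewrite ler_pM // mulr_ge0 ?modulus_ge0.
  have : mod (k + d) * q x <= 1 * 100^-1 by rewrite ler_pM ?modulus_ge0 //; lra.
  lra.
have := est _ _ _ at_ qr qp; rewrite -a3w -uE => est1.
have := est _ _ _ ar qt qm; rewrite -a3u -wE => est2.
have kz : (k * k) *: (z + z) = a3 w *: u - a3 u *: w
    - (a3 w *: u - (k * k) *: (e3 + z)) + (a3 u *: w - (k * k) *: (e3 - z)).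
  set A := a3 w *: u; set B := a3 u *: w.
  rewrite opprB [A - B + _]addrC [_ - A + _]addrA subrK addrA subrK.
  rewrite -scalerBr; congr (_ *: _).
  by rewrite opprB [e3 + z]addrC -addrA [e3 + _]addrC subrK.
have qkz : q ((k * k) *: (z + z)) <= 30^-1 + 30^-1.
  rewrite kz; apply: le_trans (seminormD qS _ _) (lerD _ est2).
  by apply: le_trans (seminormB qS _ _) _; rewrite D0 add0r.
have zz : z + z = (1 + 1) *: z by rewrite scalerDl scale1r.
have m2 : mod (1 + 1) = 2.
  by rewrite -(rmorph1 S) -rmorphD modulus_embed ?addr_ge0.
rewrite zz !(seminormZ qS) modulusM m2 in qkz.
have kk : 3^-1 * 3^-1 <= mod k * mod k.
  by apply: ler_pM; rewrite ?invr_ge0.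
have kkz : 3^-1 * 3^-1 * (2 * 1) <= mod k * mod k * (2 * q z).
  by apply: ler_pM; lra.
suff h10 : 1 <= 0 :> R by rewrite ler10 in h10.
lra.
Qed.

(** T0 has numerical radius between 2 and 2 + d, the lower bound being taken at
((e1 + e2) / 2, a1 + a2 + 2 a3); dividing by the exact value gives the required
normalisation, and 2 / (2 + d) > 1 - d. *)
Lemma not_weak_BPBp_nu : ~ weak_BPBp_nu Y.
Proof.
move=> W.
have eps0 : 0 < S (100^-1) by rewrite -(rmorph0 S) ltr_embed invr_gt0 ltr0n.
have [eta [eta0 {}W]] := W _ eps0.
have mod_eta0 : 0 < mod eta by rewrite modulus_gt0 gt_eqF.
pose d : R := Num.min 1 (mod eta).
have d0 : 0 < d by rewrite lt_min ltr01.
have d1 : d <= 1 by rewrite ge_min lexx.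
have d_eta : d <= mod eta by rewrite ge_min lexx orbT.
have [z [z1 z2 z3 qz [qp qm]]] := sum_flat H d0.
have [a3e3 qe3 a3q] := sum_a3 H.
have [|T0 T0E] := @linear_bundle K Y Y
    (fun x => a1 x *: (e3 + z) + a2 x *: (e3 - z)).
  move=> k x y; move: (e3 + z) (e3 - z) => p m.
  rewrite !linearD /= !functionalZ !scalerDl !scalerA.
  by rewrite addrACA.
have [|f fE] := @linear_bundle K Y K^o (fun x => a1 x + a2 x + 2 * a3 x).
  by move=> k x y; rewrite -[RHS]/(k * _ + _) !linearD /= !functionalZ; ring.
have fc x : mod (f x) <= nm x.
  rewrite fE (sum_normE H); apply: le_trans (modulusD _ _ _) (lerD _ _).
    exact: modulusD.
  by rewrite modulusM modulus_nat.
have n3 s : nm (e3 + s *: z) = q (e3 + s *: z).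
  by rewrite norm_kernel // linearD functionalZ ?z1 ?z2 ?a1e3 ?a2e3 mulr0 addr0.
have T0n x : nm (T0 x) <= (2 + d) * nm x.
  have /= nS := real_norm_seminorm S Y.
  have np := n3 1; have nn := n3 (- 1); rewrite scale1r in np.
  rewrite scaleN1r in nn.
  rewrite T0E; apply: le_trans (seminormD nS _ _) _; rewrite !(seminormZ nS) np nn.
  rewrite (sum_normE H) mulrDr mulrDr.
  have h1 : mod (a1 x) * q (e3 + z) <= (2 + d) * mod (a1 x).
    by rewrite mulrC ler_wpM2r ?modulus_ge0.
  have h2 : mod (a2 x) * q (e3 - z) <= (2 + d) * mod (a2 x).
    by rewrite mulrC ler_wpM2r ?modulus_ge0.
  have : 0 <= (2 + d) * q x by rewrite mulr_ge0 ?(seminorm_ge0 qS) //; lra.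
  by lra.
have bT0 := bounded_opI T0n.
pose x0 : Y := 2^-1 *: e1 + 2^-1 *: e2.
have a1x0 : a1 x0 = 2^-1 by rewrite linearD !functionalZ a1e1 a1e2 mulr0 addr0 mulr1.
have a2x0 : a2 x0 = 2^-1 by rewrite linearD !functionalZ a2e1 a2e2 mulr0 add0r mulr1.
have a3x0 : a3 x0 = 0.
  apply/eqP; rewrite -(modulus_eq0 S) eq_le modulus_ge0 andbT.
  by have := a3q x0; rewrite q_plane; lra.
have mod_half : mod 2^-1 = 2^-1.
  by rewrite modulusV modulus_nat.
have half2 : 2^-1 + 2^-1 = 1 :> R by lra.
have half2K : 2^-1 + 2^-1 = 1 :> K.
  by rewrite -mulr2n -[_^-1 *+ 2]mulr_natr mulVf ?pnatr_eq0.
have fx0 : Pi_set (x0, f).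
  apply/(Pi_setP S); split=> //; last by rewrite fE a1x0 a2x0 a3x0 mulr0 addr0.
  by rewrite (sum_normE H) a1x0 a2x0 q_plane mod_half addr0.
have Pi0 : exists w, @Pi_set K Y w by exists (x0, f).
have T0x0 : T0 x0 = e3.
  rewrite T0E a1x0 a2x0 -scalerDr addrACA subrr addr0.
  by rewrite scalerDr -scalerDl half2K scale1r.
have [vE vub vlub] := num_radius_lub S bT0 Pi0.
set v := real_radius S T0 in vE vub vlub.
have v2 : 2 <= v.
  apply: le_trans (vub _ _ fx0); rewrite T0x0 fE a1e3 a2e3 a3e3 !add0r mulr1.
  by rewrite modulus_nat.
have vd : v <= 2 + d.
  apply: vlub => x g /(Pi_setP S)[x1 gc _].
  by apply: le_trans (gc _) _; apply: le_trans (T0n _) _; rewrite x1 mulr1.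
have v0 : 0 < v by lra.
have vV : mod (S v^-1) = v^-1 by rewrite modulus_embed // invr_ge0 ltW.
have [|T TE] := @linear_bundle K Y Y (fun x => S v^-1 *: T0 x).
  by move=> k x y; rewrite linearD linearZ /= scalerDr !scalerA mulrC.
have bT : bounded_op T.
  apply: (@bounded_opI _ _ S _ _ _ (v^-1 * (2 + d))) => x.
  rewrite TE (seminormZ (real_norm_seminorm S Y)) vV -mulrA ler_wpM2l //.
  by rewrite invr_ge0 ltW.
have [wE wub wlub] := num_radius_lub S bT Pi0.
have gT x g : @Pi_set K Y (x, g) -> mod (g (T x)) = v^-1 * mod (g (T0 x)).
  by move=> _; rewrite TE functionalZ modulusM vV.
have T1 : real_radius S T = 1.
  apply/eqP; rewrite eq_le; apply/andP; split.
    by apply: wlub => x g xg; rewrite gT // ler_pdivrMl // mulr1; exact: vub.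
  rewrite -(ler_pM2l v0) mulr1; apply: vlub => x g xg.
  by have := wub _ _ xg; rewrite gT // ler_pdivrMl.
have fTx0 : mod (f (T x0)) = 2 / v.
  rewrite gT // T0x0 fE a1e3 a2e3 a3e3 !add0r mulr1.
  by rewrite modulus_nat mulrC.
have att : 1 - eta < `|f (T x0)|.
  rewrite -[ltRHS](embed_modulus S) -(ger0_embed S (ltW eta0)) -(rmorph1 S) -rmorphB.
  rewrite ltr_embed fTx0 ltr_pdivlMr //.
  nra.
have T1K : num_radius T = 1 by rewrite wE T1 rmorph1.
have [U [y [g [bU yg vU UT [x0y _]]]]] := W T x0 f bT fx0 T1K att.
(* The point y is so close to x0 that its coordinates cannot vanish. *)
have near_half (a : {linear Y -> K^o}) : (forall x, mod (a x) <= nm x) ->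
    a x0 = 2^-1 -> a y != 0.
  move=> an ax0; apply/eqP => ay; have := an (x0 - y).
  rewrite linearB ax0 /= ay subr0 mod_half => h.
  have : nm (x0 - y) < 100^-1 by rewrite -(ltr_embed S) embed_norm.
  lra.
apply: (@far_from_attaining (S v^-1) z T U y g) => //.
- by lra.
- by lra.
- by rewrite vV; apply/andP; split; rewrite lef_pV2 ?posrE //; lra.
- by rewrite TE T0E a1e1 a2e1 scale1r scale0r addr0.
- by rewrite TE T0E a1e2 a2e2 scale1r scale0r add0r.
- move=> x x1; rewrite -(ler_embed S) embed_norm; apply: le_trans (ltW UT).
  have bUT : bounded_op (U \- T).
    have [M M0 UM] := bounded_opP S bU; have [N N0 TN] := bounded_opP S bT.
    apply: (@bounded_opI _ _ S _ _ _ (M + N)) => t /=; rewrite mulrDl.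
    apply: le_trans (seminormB (real_norm_seminorm S Y) _ _) _.
    exact: lerD.
  by apply: (op_norm_lub S bUT).1; rewrite -(embed_norm S) x1 rmorph1.
- apply: (near_half a1) => //; exact: a1_le_norm.
- apply: (near_half a2) => //; exact: a2_le_norm.
- by rewrite /real_radius vU modulus_norm.
Qed.

End FailureOfWeakBPBp.

(** * A strictly convex seminorm with flat directions *)

Section RotundSeminorm.
Variables (R : realType) (K : numFieldType) (S : scalars R K).
Variables (V : lmodType K) (N : V -> R).
Variables (a : {linear V -> K^o}) (F : nat -> {linear V -> K^o}).
Hypothesis NS : seminorm S N.
Hypothesis FN : forall n x, modulus S (F n x) <= N x.
Local Notation mod := (modulus S).

Definition hypots x n : R := hypot (mod (a x)) (mod (F n x)).

(** The maximum is flat around an axis a = 1, N = 0; the sum brings in strict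
convexity, at a cost that is small where many F n vanish. *)
Definition rotund x : R := Num.max (mod (a x)) (N x) + dyadic_sum (hypots x).

Let hypots_bounded x : bounded_by (mod (a x) + N x) (hypots x).
Proof.
move=> n; rewrite hypot_ge0 /= (le_trans (hypot_le _ _)) ?modulus_ge0 //.
by rewrite lerD2l.
Qed.

Let hypotsD x y n : hypots (x + y) n <= hypots x n + hypots y n.
Proof.
apply: le_trans (hypotD _ _ _ _); apply: le_hypot; rewrite ?modulus_ge0 //;
  by rewrite linearD; exact: modulusD.
Qed.

Let dyadic_hypotsD x y :
  dyadic_sum (fun n => hypots x n + hypots y n) =
  dyadic_sum (hypots x) + dyadic_sum (hypots y).
Proof. exact: dyadic_sumD (hypots_bounded x) (hypots_bounded y). Qed.

Let hypotsD_bounded x y :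
  bounded_by (mod (a x) + N x + (mod (a y) + N y))
    (fun n => hypots x n + hypots y n).
Proof.
move=> n; have /andP[x0 xM] := hypots_bounded x n.
have /andP[y0 yM] := hypots_bounded y n.
by rewrite addr_ge0 // lerD.
Qed.

Let max_seminorm : seminorm S (fun x => Num.max (mod (a x)) (N x)).
Proof.
split=> [x y|k x].
  rewrite ge_max; apply/andP; split.
    rewrite linearD; apply: le_trans (modulusD _ _ _) (lerD _ _);
      by rewrite le_max lexx.
  apply: le_trans (seminormD NS _ _) (lerD _ _);
    by rewrite le_max lexx orbT.
by rewrite functionalZ modulusM (seminormZ NS) maxr_pMr // modulus_ge0.
Qed.

Lemma rotund_seminorm : seminorm S rotund.
Proof.
split=> [x y|k x]; rewrite /rotund.
  have := seminormD max_seminorm x y.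
  have := ler_dyadic_sum (hypots_bounded _) (hypotsD_bounded _ _) (hypotsD x y).
  by rewrite dyadic_hypotsD; lra.
rewrite (seminormZ max_seminorm) mulrDr; congr (_ + _).
rewrite -(dyadic_sumZ _ (hypots_bounded x)); congr dyadic_sum.
apply/funext => n.
by rewrite /hypots !functionalZ !modulusM hypotZ // modulus_ge0.
Qed.

Lemma rotund_ge x : 2 * mod (a x) <= rotund x /\ N x <= rotund x.
Proof.
have le1 : mod (a x) <= Num.max (mod (a x)) (N x) by rewrite le_max lexx.
have le2 : N x <= Num.max (mod (a x)) (N x) by rewrite le_max lexx orbT.
have := modulus_ge0 S (a x).
have : mod (a x) <= dyadic_sum (hypots x).
  rewrite -[leLHS]dyadic_sum_cst.
  apply: (@ler_dyadic_sum _ (mod (a x)) _ _ _ _ (hypots_bounded x)) => n.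
    by rewrite modulus_ge0 lexx.
  exact: hypot_ge_l.
by rewrite /rotund => h h0; split; lra.
Qed.

Lemma rotund_le x : rotund x <= 2 * (mod (a x) + N x).
Proof.
have := dyadic_sum_le (hypots_bounded x).
have : Num.max (mod (a x)) (N x) <= mod (a x) + N x.
  by rewrite ge_max lerDl lerDr modulus_ge0 (seminorm_ge0 NS).
by rewrite /rotund; lra.
Qed.

(** Equality of rotund forces equality in each of the hypotenuses, hence both
equality of moduli and equality of arguments; together these say that the pairs
(a u, F n u) and (a v, F n v) are proportional. *)
Lemma rotund_strict u v : rotund (u + v) = rotund u + rotund v ->
  forall n, a v * F n u = a u * F n v.
Proof.
move=> e n.
have e0 : hypots u n + hypots v n - hypots (u + v) n = 0.
  have gap_bounded : bounded_by (mod (a u) + N u + (mod (a v) + N v))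
      (fun n => hypots u n + hypots v n - hypots (u + v) n).
    move=> i; rewrite subr_ge0 hypotsD /=.
    have /andP[_] := hypotsD_bounded u v i.
    have /andP[] := hypots_bounded (u + v) i; lra.
  apply: (dyadic_sum_eq0 gap_bounded).
  have := dyadic_sumD gap_bounded (hypots_bounded (u + v)).
  under [X in dyadic_sum X]eq_fun do rewrite subrK.
  rewrite dyadic_hypotsD; have := seminormD max_seminorm u v.
  by move: e; rewrite /rotund; lra.
have {e0}e0 : hypots (u + v) n = hypots u n + hypots v n by lra.
have [||ea eF cross] := hypotD_eq _ _ e0.
- by rewrite modulus_ge0 linearD modulusD.
- by rewrite modulus_ge0 linearD modulusD.
rewrite !linearD in ea eF.
have {ea}ea := modulusD_aligned ea; have {eF}eF := modulusD_aligned eF.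
set x := a u in ea cross *; set y := a v in ea cross *.
set s := F n u in eF cross *; set t := F n v in eF cross *.
have [x0|x0] := eqVneq x 0.
  move/eqP: cross; rewrite x0 modulus0 mul0r eq_sym mulf_eq0 !modulus_eq0 mul0r.
  by case/orP => /eqP ->; rewrite ?mul0r ?mulr0.
have [t0|t0] := eqVneq t 0.
  move/eqP: cross; rewrite t0 modulus0 mulr0 eq_sym mulf_eq0 !modulus_eq0 mulr0.
  by case/orP => /eqP ->; rewrite ?mul0r ?mulr0.
(* The two equations on arguments, ea and eF, are multiplied and the moduli
   cancelled by means of cross. *)
have nz : S (mod x * mod t) != 0.
  by rewrite -(rmorph0 S) (inj_eq (@embed_inj _ _ S)) mulf_neq0 ?modulus_eq0.
apply: (mulfI nz).
transitivity ((S (mod x) * y) * (S (mod t) * s)); first by rewrite rmorphM; ring.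
rewrite -ea eF; transitivity (S (mod y * mod s) * (x * t)).
  by rewrite rmorphM; ring.
by rewrite -cross.
Qed.

Lemma rotund_axis e : a e = 1 -> N e = 0 -> rotund e = 2.
Proof.
move=> ae Ne; have F0 n : F n e = 0.
  by apply/eqP; rewrite -(modulus_eq0 S) eq_le modulus_ge0 andbT -Ne.
rewrite /rotund ae Ne modulus1 max_l // (_ : hypots e = fun=> 1).
  by rewrite dyadic_sum_cst.
by apply/funext => n; rewrite /hypots ae F0 modulus1 modulus0 hypot_r0.
Qed.

Lemma rotund_flat e z m : a e = 1 -> N e = 0 -> a z = 0 -> N z <= 1 ->
  (forall n, (n < m)%N -> F n z = 0) -> rotund (e + z) <= 2 + 2^-1 ^+ m.
Proof.
move=> ae Ne az Nz Fz.
have F0 n : F n e = 0.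
  by apply/eqP; rewrite -(modulus_eq0 S) eq_le modulus_ge0 andbT -Ne.
rewrite /rotund linearD ae az addr0 modulus1 max_l; last first.
  by apply: le_trans (seminormD NS _ _) _; rewrite Ne add0r.
have c1 : bounded_by 1 (fun=> 1 : R) by move=> n; rewrite ler01 lexx.
have bF : bounded_by 1 (fun n => mod (F n z)).
  by move=> n; rewrite modulus_ge0 (le_trans (FN _ _)).
have bD : bounded_by (1 + 1) (fun n => 1 + mod (F n z)).
  by move=> n; have /andP[] := bF n; rewrite lerD2l => *; rewrite addr_ge0.
have := ler_dyadic_sum (hypots_bounded (e + z)) bD.
have -> : dyadic_sum (fun n => 1 + mod (F n z)) = 1 + dyadic_sum (fun n => mod (F n z)).
  by rewrite (dyadic_sumD c1 bF) dyadic_sum_cst.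
move=> h.
have tail : dyadic_sum (fun n => mod (F n z)) <= 2^-1 ^+ m.
  by rewrite -[leRHS]mul1r; apply: (dyadic_sum_tail bF) => k /Fz ->; exact: modulus0.
have {h} : dyadic_sum (hypots (e + z)) <= 1 + dyadic_sum (fun n => mod (F n z)).
  apply: h => n; rewrite /hypots !linearD ae az F0 addr0 add0r modulus1.
  by apply: hypot_le => //; exact: modulus_ge0.
lra.
Qed.

End RotundSeminorm.

(** * The renorming *)

(** Were the common kernel of n functionals trivial, adding one vector for each
functional would span V. *)
Lemma infinite_dimensional_kernel (K : fieldType) (V : lmodType K)
  (F : nat -> {linear V -> K^o}) n : infinite_dimensional V ->
  exists2 z, z != 0 & forall i, (i < n)%N -> F i z = 0.
Proof.
move=> infV; apply: contrapT => nz; apply: infV.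
pose spanned k := exists (m : nat) (e : 'I_m -> V), forall x,
  (forall i, (i < k)%N -> F i x = 0) ->
  exists c : 'I_m -> K, x = \sum_(i < m) c i *: e i.
suff : spanned 0%N by move=> [m [e em]]; exists m, e => x; exact: em.
have : spanned n.
  exists 0%N, (fun=> 0) => x xn; exists (fun=> 0); rewrite big_ord0.
  by apply/eqP/negPn/negP => x0; apply: nz; exists x.
elim: n {nz} => // n IH [m [e em]]; apply: IH.
have [[w [wn Fw]]|nw] := pselect (exists w,
    (forall i, (i < n)%N -> F i w = 0) /\ F n w != 0); last first.
  exists m, e => x xn; apply: em => i; rewrite ltnS leq_eqVlt.
  case/predU1P => [->|]; last exact: xn.
  by apply/eqP/negPn/negP => Fx; apply: nw; exists x.
exists m.+1, (fun i => oapp e w (unlift ord0 i)) => x xn.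
have [i|c xc] := em (x - (F n x / F n w) *: w).
  rewrite ltnS leq_eqVlt => /predU1P[->|lin]; rewrite linearB linearZ /=.
    by rewrite -[_ *: _]/(_ * _) divfK ?subrr.
  by rewrite (xn i lin) (wn i lin) scaler0 subrr.
exists (fun i => oapp c (F n x / F n w) (unlift ord0 i)).
rewrite big_ord_recl unlift_none /=.
under eq_bigr do rewrite liftK /=.
by rewrite -xc addrC subrK.
Qed.

Section Construction.
Variables (R : realType) (K : numFieldType) (S : scalars R K).
Variable X : normedModType K.
Local Notation mod := (modulus S).
Local Notation nm := (@real_norm R K S X).

Let nS : seminorm S nm := real_norm_seminorm S X.

Lemma norming_functional (x : X) : exists2 f : {linear X -> K^o},
  forall y, mod (f y) <= nm y & f x = S (nm x).
Proof. exact: (hahn_banach (seminormD nS) (seminormZ nS)). Qed.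

Lemma dual_functional (x : X) : x != 0 ->
  exists2 f : {linear X -> K^o}, exists2 M : R, 0 <= M &
    forall y, mod (f y) <= M * nm y & f x = 1.
Proof.
move=> x0; have [f fb fx] := norming_functional x.
have nx : 0 < nm x by rewrite modulus_gt0 normr_eq0.
have [|g gE] := @linear_bundle K X K^o (fun y => (f x)^-1 * f y).
  by move=> k y z; rewrite -[RHS]/(k * _ + _) linearD /= functionalZ; ring.
exists g; last by rewrite gE mulVf // fx -(modulus_gt0 S) modulus_embed // ltW.
exists (mod (f x)^-1) => [|y]; first exact: modulus_ge0.
by rewrite gE modulusM ler_wpM2l ?modulus_ge0.
Qed.

(** Norming functionals of a dense sequence separate points: if all of them kill
x, then the one of a nearby point d is at most |x - d| at d, where its value is
|d|. *)
Lemma separating_functionals : separable_space X ->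
  exists f : nat -> {linear X -> K^o},
    (forall n x, mod (f n x) <= nm x) /\
    forall x, (forall n, f n x = 0) -> x = 0.
Proof.
move=> [D /countable_injP[j jinj] dD].
pose d n : X := xget 0 [set x | D x /\ j x = n].
have dj x : D x -> d (j x) = x.
  move=> Dx; have [] := @xgetPex _ 0 [set y | D y /\ j y = j x]
    (ex_intro _ x (conj Dx erefl)).
  by move=> Dd; apply: jinj; exact/mem_set.
have /choice[f fP] : forall n, exists f : {linear X -> K^o},
    (forall y, mod (f y) <= nm y) /\ f (d n) = S (nm (d n)).
  by move=> n; have [f fb fd] := norming_functional (d n); exists f.
exists f; split=> [n x|x fx]; first exact: (fP n).1.
apply: contrapT => /eqP x0.
have nx : 0 < nm x by rewrite modulus_gt0 normr_eq0.
have [||y [xy Dy]] := dD (ball x (S (2^-1 * nm x))).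
- exists x; apply: ballxx.
  by rewrite -(rmorph0 S) ltr_embed mulr_gt0 // invr_gt0.
- exact: ball_open.
have {xy} xy : nm (x - y) < 2^-1 * nm x.
  by move: xy; rewrite -ball_normE /= -(embed_norm S) ltr_embed.
have [fb fy] := fP (j y); rewrite dj // in fy.
have := fb (x - y); rewrite linearB fx sub0r modulusN fy modulus_embed; last first.
  exact: modulus_ge0.
move=> le1; have := seminormD nS (x - y) y; rewrite subrK; lra.
Qed.

Record biorthogonal_triple (a1 a2 a3 : {linear X -> K^o}) (e1 e2 e3 : X) : Prop :=
  BiorthogonalTriple {
    dual1 : [/\ a1 e1 = 1, a1 e2 = 0 & a1 e3 = 0];
    dual2 : [/\ a2 e1 = 0, a2 e2 = 1 & a2 e3 = 0];
    dual3 : [/\ a3 e1 = 0, a3 e2 = 0 & a3 e3 = 1];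
    dual_bounded : exists2 M : R, 0 <= M & forall x,
      [/\ mod (a1 x) <= M * nm x, mod (a2 x) <= M * nm x
        & mod (a3 x) <= M * nm x] }.

(** Each new vector is taken in the kernel of the functionals found so far, and
each new functional is corrected by them to vanish on the earlier vectors. *)
Lemma exists_biorthogonal_triple : infinite_dimensional X ->
  exists a1 a2 a3 e1 e2 e3, biorthogonal_triple a1 a2 a3 e1 e2 e3.
Proof.
move=> infX.
have [e1 e1n _] := infinite_dimensional_kernel (fun=> \0 : {linear X -> K^o}) 0 infX.
have [a1 [M1 M10 a1b] a1e1] := dual_functional e1n.
have [e2 e2n a1e2] := infinite_dimensional_kernel (fun=> a1) 1 infX.
have {}a1e2 : a1 e2 = 0 by exact: (a1e2 0%N).
have [b2 [M2 M20 b2b] b2e2] := dual_functional e2n.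
have [|a2 a2E] := @linear_bundle K X K^o (fun x => b2 x - b2 e1 * a1 x).
  move=> k y z; rewrite -[RHS]/(k * _ + _) (linearD b2) (linearD a1).
  by rewrite (functionalZ b2) (functionalZ a1); ring.
have [e3 e3n ke3] := infinite_dimensional_kernel
  (fun n => if n == 0%N then a1 else a2) 2 infX.
have a1e3 : a1 e3 = 0 by exact: (ke3 0%N).
have a2e3 : a2 e3 = 0 by exact: (ke3 1%N).
have [b3 [M3 M30 b3b] b3e3] := dual_functional e3n.
have [|a3 a3E] := @linear_bundle K X K^o
    (fun x => b3 x - b3 e1 * a1 x - b3 e2 * a2 x).
  move=> k y z; rewrite -[RHS]/(k * _ + _) (linearD b3) (linearD a1) (linearD a2).
  by rewrite (functionalZ b3) (functionalZ a1) (functionalZ a2); ring.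
have a2e1 : a2 e1 = 0 by rewrite a2E a1e1 mulr1 subrr.
have a2e2 : a2 e2 = 1 by rewrite a2E a1e2 mulr0 subr0.
exists a1, a2, a3, e1, e2, e3; split=> //.
  by rewrite !a3E a1e1 a1e2 a1e3 a2e1 a2e2 a2e3; rewrite !mulr1 !mulr0 !subr0 !subrr b3e3.
pose c := mod (b2 e1) * M1; pose c' := mod (b3 e1) * M1.
pose c'' := mod (b3 e2) * (M2 + c).
have c0 : 0 <= c by rewrite mulr_ge0 ?modulus_ge0.
have c0' : 0 <= c' by rewrite mulr_ge0 ?modulus_ge0.
have c0'' : 0 <= c'' by rewrite mulr_ge0 ?addr_ge0 ?modulus_ge0.
have a2b x : mod (a2 x) <= (M2 + c) * nm x.
  rewrite a2E mulrDl; apply: le_trans (modulusB _ _ _) (lerD (b2b x) _).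
  by rewrite modulusM -mulrA ler_wpM2l ?modulus_ge0.
have a3b x : mod (a3 x) <= (M3 + c' + c'') * nm x.
  rewrite a3E !mulrDl; apply: le_trans (modulusB _ _ _) (lerD _ _).
    apply: le_trans (modulusB _ _ _) (lerD (b3b x) _).
    by rewrite modulusM -mulrA ler_wpM2l ?modulus_ge0.
  by rewrite modulusM -mulrA ler_wpM2l ?modulus_ge0.
exists (M1 + (M2 + c) + (M3 + c' + c'')); first by lra.
move=> x; have x0 := seminorm_ge0 nS x; split.
- by apply: le_trans (a1b x) _; rewrite ler_wpM2r //; lra.
- by apply: le_trans (a2b x) _; rewrite ler_wpM2r //; lra.
- by apply: le_trans (a3b x) _; rewrite ler_wpM2r //; lra.
Qed.

Section Renorming.
Variables (a1 a2 a3 : {linear X -> K^o}) (e1 e2 e3 : X).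
Hypothesis dual : biorthogonal_triple a1 a2 a3 e1 e2 e3.
Variable f : nat -> {linear X -> K^o}.
Hypothesis fb : forall n x, mod (f n x) <= nm x.
Hypothesis fsep : forall x, (forall n, f n x = 0) -> x = 0.

Lemma exists_complement_projection : exists P : {linear X -> X},
  forall x, P x = x - (a1 x *: e1 + a2 x *: e2 + a3 x *: e3).
Proof.
apply: linear_bundle => k x y.
rewrite (linearD a1) (linearD a2) (linearD a3) !functionalZ !scalerDl -!scalerA.
set u1 := a1 x *: e1; set u2 := a2 x *: e2; set u3 := a3 x *: e3.
set w1 := a1 y *: e1; set w2 := a2 y *: e2; set w3 := a3 y *: e3.
rewrite (addrACA (k *: u1)) (addrACA (k *: u1 + k *: u2)) -!scalerDr.
by rewrite opprD addrACA scalerBr.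
Qed.

Variable P : {linear X -> X}.
Hypothesis PE : forall x, P x = x - (a1 x *: e1 + a2 x *: e2 + a3 x *: e3).

Let E : R := nm e1 + nm e2 + nm e3.

Let E_ge0 : 0 <= E.
Proof. by rewrite !addr_ge0 ?modulus_ge0. Qed.

Let span_norm x : nm (a1 x *: e1 + a2 x *: e2 + a3 x *: e3) <=
  mod (a1 x) * nm e1 + mod (a2 x) * nm e2 + mod (a3 x) * nm e3.
Proof.
rewrite -!(seminormZ nS); apply: le_trans (seminormD nS _ _) _.
by rewrite lerD2r (seminormD nS).
Qed.

Let Pe : [/\ P e1 = 0, P e2 = 0 & P e3 = 0].
Proof.
case: (dual1 dual) (dual2 dual) (dual3 dual) => r1 r2 r3 [s1 s2 s3] [t1 t2 t3].
by rewrite !PE r1 r2 r3 s1 s2 s3 t1 t2 t3 !scale0r !scale1r !addr0 !add0r !subrr.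
Qed.

Let P_id x : a1 x = 0 -> a2 x = 0 -> a3 x = 0 -> P x = x.
Proof. by move=> h1 h2 h3; rewrite PE h1 h2 h3 !scale0r !addr0 subr0. Qed.

Let N x : R := nm (P x).

Let NS : seminorm S N.
Proof.
split=> [x y|k x]; first by rewrite /N linearD (seminormD nS).
by rewrite /N linearZ (seminormZ nS).
Qed.

Let F n : {linear X -> K^o} := f n \o P.

Let FN n x : mod (F n x) <= N x. Proof. exact: fb. Qed.

Definition rotund_part : X -> R := rotund S N a3 F.
Local Notation q := rotund_part.

Let qS : seminorm S q := rotund_seminorm a3 NS FN.

Definition renorming x : R := mod (a1 x) + mod (a2 x) + q x.

Let rS : seminorm S renorming.
Proof.
split=> [x y|k x]; rewrite /renorming.
  have := seminormD qS x y; have := modulusD S (a1 x) (a1 y).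
  have := modulusD S (a2 x) (a2 y); rewrite !linearD; lra.
by rewrite !functionalZ !modulusM (seminormZ qS) !mulrDr.
Qed.

(** x is P x plus its coordinates along e1, e2, e3, all controlled by the new
norm. *)
Let norm_le_renorming x : nm x <= (1 + E) * renorming x.
Proof.
have le1 : nm x <= N x + (mod (a1 x) * nm e1 + mod (a2 x) * nm e2
    + mod (a3 x) * nm e3).
  apply: le_trans (lerD (lexx (N x)) (span_norm x)).
  by have := seminormD nS (P x) (a1 x *: e1 + a2 x *: e2 + a3 x *: e3);
    rewrite {1}PE subrK.
have [le2 le3] := rotund_ge a3 FN x; rewrite -/(q x) in le2 le3.
have := modulus_ge0 S (a1 x); have := modulus_ge0 S (a2 x).
have := modulus_ge0 S (a3 x); have := seminorm_ge0 nS e1.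
have := seminorm_ge0 nS e2; have := seminorm_ge0 nS e3.
rewrite /E /renorming => g3 g2 g1 m3 m2 m1.
have h1 : mod (a1 x) * nm e1 <= mod (a1 x) * (nm e1 + nm e2 + nm e3).
  by rewrite ler_wpM2l //; lra.
have h2 : mod (a2 x) * nm e2 <= mod (a2 x) * (nm e1 + nm e2 + nm e3).
  by rewrite ler_wpM2l //; lra.
have h3 : mod (a3 x) * nm e3 <= q x * (nm e1 + nm e2 + nm e3).
  by apply: ler_pM => //; lra.
lra.
Qed.

Let renorming_le_norm : exists2 M, 0 < M & forall x, renorming x <= M * nm x.
Proof.
have [M M0 aM] := dual_bounded dual.
exists (4 * M + 2 * (1 + M * E)).
  have : 0 <= M * E by exact: mulr_ge0.
  lra.
move=> x; have [b1 b2 b3] := aM x.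
have := rotund_le a3 NS FN x; rewrite -/(q x) /renorming.
have : N x <= (1 + M * E) * nm x.
  rewrite /N PE; apply: le_trans (seminormB nS _ _) _.
  rewrite mulrDl mul1r lerD2l; apply: le_trans (span_norm x) _.
  have := seminorm_ge0 nS e1; have := seminorm_ge0 nS e2.
  have := seminorm_ge0 nS e3; rewrite /E; nra.
lra.
Qed.

Definition renorming_norm : norm_on X.
Proof.
refine (@NormOn K X (fun x => S (renorming x)) _ _ _).
- by move=> x y; rewrite -rmorphD ler_embed (seminormD rS).
- by move=> k x; rewrite (seminormZ rS) rmorphM embed_modulus.
- move=> x; rewrite -(rmorph0 S) => /(@embed_inj _ _ S) r0.
  have := norm_le_renorming x; rewrite r0 mulr0 => n0.
  by apply/eqP; rewrite -(real_norm_eq0 S) eq_le n0 (seminorm_ge0 nS).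
Defined.

Lemma renorming_equivalent : equivalent_norm renorming_norm.
Proof.
have [C C0 rC] := renorming_le_norm.
have c0 : 0 < 1 + E by rewrite ltr_pwDl.
exists (S (1 + E)^-1), (S C); split.
- by rewrite -(rmorph0 S) ltr_embed invr_gt0.
- by rewrite -(rmorph0 S) ltr_embed.
move=> x; rewrite -!(embed_norm S) -!rmorphM /=; split; rewrite ler_embed //.
by rewrite ler_pdivrMl.
Qed.

Lemma renorming_l1_plane_sum : infinite_dimensional X ->
  @l1_plane_sum R K S (renormed renorming_norm) q a1 a2 a3 e1 e2 e3.
Proof.
move=> infX; have [Pe1 Pe2 Pe3] := Pe.
case: (dual1 dual) (dual2 dual) (dual3 dual) => r1 r2 r3 [s1 s2 s3] [t1 t2 t3].
have N0 e : P e = 0 -> N e = 0 by move=> Pe0; rewrite /N Pe0 (seminorm0 nS).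
have q0 x : a3 x = 0 -> N x = 0 -> q x = 0.
  move=> x3 Nx; apply/eqP; rewrite eq_le (seminorm_ge0 qS) andbT.
  by apply: le_trans (rotund_le a3 NS FN x) _; rewrite x3 Nx modulus0 addr0 mulr0.
split.
- exact: qS.
- by move=> x; apply: modulus_embed; exact: (seminorm_ge0 rS).
- by split.
- by split=> //; apply: q0 => //; exact: N0.
- split=> //; first by apply: rotund_axis => //; exact: N0.
  by move=> x; have [] := rotund_ge a3 FN x.
- move=> u v u1 v1 uv.
  have e : q (u + v) = q u + q v.
    apply/eqP; rewrite eq_le (seminormD qS) /= u1 v1.
    by apply: le_trans uv; lra.
  have FE := rotund_strict NS FN e.
  have a3D : a3 (a3 v *: u - a3 u *: v) = 0.
    by rewrite linearB !(functionalZ a3) mulrC subrr.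
  apply: q0 => //; apply: N0; apply: fsep => n.
  by rewrite -[LHS]/(F n _) linearB !(functionalZ (F n)) FE subrr.
- move=> eta eta0.
  pose m := Num.bound eta^-1.
  have mE : 2^-1 ^+ m <= eta.
    have := archi_boundP (_ : 0 <= eta^-1); rewrite invr_ge0 ltW // => /(_ isT) mb.
    rewrite exprVn -(lef_pV2 (x := eta)) ?posrE ?invr_gt0 ?exprn_gt0 // invrK.
    rewrite (le_trans (ltW mb)) // -natrX ler_nat.
    exact: ltnW (ltn_expl _ _).
  (* G lists a1, a2, a3 and then the F i. *)
  pose G n : {linear X -> K^o} :=
    match n with 0 => a1 | 1 => a2 | 2 => a3 | i.+3 => F i end%N.
  have [z0 z0n Gz] := infinite_dimensional_kernel G m.+3 infX.
  have nz : 0 < nm z0 by rewrite modulus_gt0 normr_eq0.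
  pose z := S (nm z0)^-1 *: z0.
  have az (a : {linear X -> K^o}) : a z0 = 0 -> a z = 0.
    by move=> a0; rewrite functionalZ a0 mulr0.
  have z1 : a1 z = 0 by apply: az; exact: (Gz 0%N).
  have z2 : a2 z = 0 by apply: az; exact: (Gz 1%N).
  have z3 : a3 z = 0 by apply: az; exact: (Gz 2%N).
  have zF n : (n < m)%N -> F n z = 0 by move=> nm_; apply: az; exact: (Gz n.+3).
  have Nz : N z = 1.
    rewrite /N P_id // (seminormZ nS) modulus_embed ?invr_ge0 ?(ltW nz) //.
    by rewrite mulVf // gt_eqF.
  exists z; split=> //.
    by have [_] := rotund_ge a3 FN z; rewrite Nz.
  have flat w : a3 w = 0 -> N w <= 1 -> (forall n, (n < m)%N -> F n w = 0) ->
      q (e3 + w) <= 2 + eta.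
    move=> w3 Nw Fw; apply: le_trans (rotund_flat NS FN t3 (N0 _ Pe3) w3 Nw Fw) _.
    by rewrite lerD2l.
  split; apply: flat => //; rewrite ?Nz ?(seminormN NS) ?Nz ?linearN ?z3 ?oppr0 //.
  by move=> n nm_; rewrite linearN zF // oppr0.
Qed.

End Renorming.

Theorem renorming_fails_BPBp_nu : infinite_dimensional X -> separable_space X ->
  exists p : norm_on X, [/\ equivalent_norm p, ~ weak_BPBp_nu (renormed p)
    & ~ BPBp_nu (renormed p)].
Proof.
move=> infX sepX.
have [a1 [a2 [a3 [e1 [e2 [e3 dual]]]]]] := exists_biorthogonal_triple infX.
have [f [fb fsep]] := separating_functionals sepX.
have [P PE] := exists_complement_projection a1 a2 a3 e1 e2 e3.
have nW := not_weak_BPBp_nu (renorming_l1_plane_sum dual fb fsep PE infX).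
exists (renorming_norm fb PE); split=> //.
  exact: renorming_equivalent.
by move/(BPBp_nu_weak S).
Qed.

End Construction.

Theorem theorem5p3 (R : realType) :
  (forall X : completeNormedModType R,
     infinite_dimensional X -> separable_space X ->
     exists p : norm_on X,
       [/\ equivalent_norm p, ~ weak_BPBp_nu (renormed p)
         & ~ BPBp_nu (renormed p)]) /\
  (forall X : completeNormedModType R[i],
     infinite_dimensional X -> separable_space X ->
     exists p : norm_on X,
       [/\ equivalent_norm p, ~ weak_BPBp_nu (renormed p)
         & ~ BPBp_nu (renormed p)]).
Proof.
split=> X.
  exact: (renorming_fails_BPBp_nu (real_scalars R)).
exact: (renorming_fails_BPBp_nu (complex_scalars R)).
Qed.
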